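(* Let $\mathbb{K}\in\{\mathbb{R},\mathbb{C}\}$, let $A\in\mathbb{K}^{n\times n}$ be self-adjoint with eigenvalues $\lambda_1\ge\dots\ge\lambda_n$ (with multiplicity), set $\lambda_0:=\infty$, and let $0\le j<h<k\le\mathrm{rank}(A)$, $k<n$, be such that $\lambda_j>\lambda_{j+1}$ and $\lambda_k>\lambda_{k+1}$. Let $$\mathcal{A}=\{B\in\mathbb{K}^{n\times n}: B=B^*,\ \lambda_j(B)>\lambda_{j+1}(B),\ \lambda_k(B)>\lambda_{k+1}(B)\},$$ fix a unitarily invariant norm $\|\cdot\|$, and consider the map $f$ on $\mathcal{A}$ given by $f(B)=\Lambda\text{-adm}_h(B)$. Then the condition number $\kappa[f](A)$ of $f$ at $A$ satisfies $$\kappa[f](A):=\lim_{\epsilon\to0^+}\ \sup_{\substack{B\in\mathcal{A}\\0<\|A-B\|<\epsilon}}\frac{d_H(\Lambda\text{-adm}_h(A),\Lambda\text{-adm}_h(B))}{\|A-B\|}\le\frac{1}{\lambda_j-\lambda_{j+1}}+\frac{1}{\lambda_k-\lambda_{k+1}}.$$ If $j=0$, then the first term on the right-hand side should be omitted.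
   Context: For Hermitian $B$, $\lambda_1(B)\ge\dots\ge\lambda_n(B)$ are its eigenvalues with multiplicity, and $\lambda_0(B):=\infty$. For $B\in\mathcal{A}$ and $\ell\in\{j,k\}$, $\mathcal{X}_\ell(B)$ is the (unique, because of the gap) dominant eigenspace of dimension $\ell$, i.e. the span of orthonormal eigenvectors of $B$ for $\lambda_1(B),\dots,\lambda_\ell(B)$; $\mathcal{X}_0(B)=\{0\}$. Let $\mathcal{G}_{n,h}$ be the set of $h$-dimensional subspaces of $\mathbb{K}^n$. Then $\Lambda\text{-adm}_h(B)=\{\mathcal{S}\in\mathcal{G}_{n,h}:\mathcal{X}_j(B)\subseteq\mathcal{S}\subseteq\mathcal{X}_k(B)\}$. Principal angles: for subspaces $\mathcal{S},\mathcal{T}$ with orthonormal-column basis matrices $S,T$ and $m=\min\{\dim\mathcal{S},\dim\mathcal{T}\}$, the principal angles $0\le\theta_1\le\dots\le\theta_m\le\pi/2$ are given by $\cos\theta_i=\sigma_i(S^*T)$ (singular values non-increasing), $\Theta(\mathcal{S},\mathcal{T})=\mathrm{diag}(\theta_1,\dots,\theta_m)$, and $\sin\Theta$ is the diagonal matrix of sines. A unitarily invariant norm on $\mathbb{K}^{n\times n}$ is one with $\|UMV\|=\|M\|$ for all unitary (orthogonal if $\mathbb{K}=\mathbb{R}$) $U,V$; it is evaluated at smaller matrices by zero padding. $d_H$ is the Hausdorff distance associated with the metric $(\mathcal{T}_1,\mathcal{T}_2)\mapsto\|\sin\Theta(\mathcal{T}_1,\mathcal{T}_2)\|$ on $\mathcal{G}_{n,h}$: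 for $\mathfrak{C},\mathfrak{D}\subseteq\mathcal{G}_{n,h}$, $$d_H(\mathfrak{C},\mathfrak{D})=\max\Big\{\sup_{\mathcal{C}\in\mathfrak{C}}\inf_{\mathcal{D}\in\mathfrak{D}}\|\sin\Theta(\mathcal{C},\mathcal{D})\|,\ \sup_{\mathcal{D}\in\mathfrak{D}}\inf_{\mathcal{C}\in\mathfrak{C}}\|\sin\Theta(\mathcal{C},\mathcal{D})\|\Big\}.$$ *)

(* Defs.v *)
From HB Require Import structures.
From mathcomp Require Import all_boot all_order all_algebra.
From mathcomp Require Import complex.
From mathcomp Require Import all_classical all_reals all_analysis.

Set Implicit Arguments.
Unset Strict Implicit.
Unset Printing Implicit Defensive.

Import Order.TTheory GRing.Theory Num.Theory.
Import numFieldNormedType.Exports.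

Local Open Scope classical_set_scope.
Local Open Scope ring_scope.

Inductive scalar_kind := RealScalars | ComplexScalars.

Definition scalar_field (R : realType) (F : scalar_kind) : numFieldType :=
  match F with RealScalars => R | ComplexScalars => R[i] end.

Definition of_real (R : realType) (F : scalar_kind) : R -> scalar_field R F :=
  match F with
  | RealScalars => fun x => x
  | ComplexScalars => fun x => x%:C%C
  end.

Definition conj_scalar (R : realType) (F : scalar_kind) :
    scalar_field R F -> scalar_field R F :=
  match F with
  | RealScalars => fun x => x
  | ComplexScalars => fun z : R[i] => z^*
  end.

Section Definitions.
Context (R : realType) (F : scalar_kind).
Local Notation K := (scalar_field R F).

Definition adjoint (p q : nat) (M : 'M[K]_(p, q)) : 'M[K]_(q, p) :=
  map_mx (@conj_scalar R F) M^T.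

Definition selfadjoint (n : nat) (B : 'M[K]_n) : Prop := B = adjoint B.

Definition orthonormal_cols (p q : nat) (V : 'M[K]_(p, q)) : Prop :=
  adjoint V *m V = 1%:M.

Definition unitary (n : nat) (U : 'M[K]_n) : Prop :=
  adjoint U *m U = 1%:M /\ U *m adjoint U = 1%:M.

Definition colspan (n l : nat) (V : 'M[K]_(n, l)) : {vspace 'cV[K]_n} :=
  <<[tuple col i V | i < l]>>%VS.

(* The real roots of the characteristic polynomial, with multiplicity, in
   non-increasing order. The conditions determine the sequence; one exists for
   every self-adjoint B. *)
Definition eigenvalues (n : nat) (B : 'M[K]_n) : seq R :=
  xget [::] [set s : seq R | sorted >=%R s /\
    char_poly B = \prod_(x <- s) ('X - (of_real F x)%:P)].

(* eigval B i is the i-th largest eigenvalue, counting from i = 1. *)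
Definition eigval (n : nat) (B : 'M[K]_n) (i : nat) : R :=
  nth 0 (eigenvalues B) i.-1.

Definition lambda (n : nat) (B : 'M[K]_n) (i : nat) : \bar R :=
  if i == 0%N then +oo%E else (eigval B i)%:E.

Definition eigengap (n : nat) (B : 'M[K]_n) (l : nat) : Prop :=
  (lambda B l.+1 < lambda B l)%E.

(* The choice is unique when B is self-adjoint with a gap at l. *)
Definition dominant_eigenspace (n : nat) (l : nat) (B : 'M[K]_n) :
    {vspace 'cV[K]_n} :=
  xget 0%VS [set X : {vspace 'cV[K]_n} | exists V : 'M[K]_(n, l),
    [/\ orthonormal_cols V,
        forall i : 'I_l,
          B *m col i V = of_real F (eigval B i.+1) *: col i V
      & X = colspan V]].

Definition grassmannian (n h : nat) : set {vspace 'cV[K]_n} :=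
  [set S : {vspace 'cV[K]_n} | \dim S = h].

Definition lambda_adm (n j h k : nat) (B : 'M[K]_n) : set {vspace 'cV[K]_n} :=
  [set S : {vspace 'cV[K]_n} | [/\ grassmannian h S,
     (dominant_eigenspace j B <= S)%VS & (S <= dominant_eigenspace k B)%VS]].

(* M^* M has the squared singular values of M as its eigenvalues, together
   with q - p further zeros when p < q. *)
Definition singular_values (p q : nat) (M : 'M[K]_(p, q)) : seq R :=
  take (minn p q) [seq Num.sqrt x | x <- eigenvalues (adjoint M *m M)].

Definition orthonormal_basis (n : nat) (S : {vspace 'cV[K]_n}) :
    'M[K]_(n, \dim S) :=
  xget 0 [set V : 'M[K]_(n, \dim S) | orthonormal_cols V /\ colspan V = S].

Definition principal_angles (n : nat) (S T : {vspace 'cV[K]_n}) : seq R :=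
  [seq acos s | s <- singular_values
                       (adjoint (orthonormal_basis S) *m orthonormal_basis T)].

(* sin Theta(S, T), zero-padded to size n by the default value of nth. *)
Definition sin_Theta (n : nat) (S T : {vspace 'cV[K]_n}) : 'M[K]_n :=
  diag_mx (\row_(i < n)
    of_real F (nth 0 [seq sin t | t <- principal_angles S T] i)).

Definition unitarily_invariant_norm (n : nat) (N : 'M[K]_n -> R) : Prop :=
  [/\ forall M, N M = 0 -> M = 0,
      forall (a : K) M, of_real F (N (a *: M)) = `|a| * of_real F (N M),
      forall M M', N (M + M') <= N M + N M'
    & forall U V M, unitary U -> unitary V -> N (U *m M *m V) = N M].

Definition hausdorff_dist (n : nat) (N : 'M[K]_n -> R)
    (C D : set {vspace 'cV[K]_n}) : \bar R :=
  Order.max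
    (ereal_sup [set ereal_inf [set (N (sin_Theta S T))%:E | T in D] | S in C])
    (ereal_sup [set ereal_inf [set (N (sin_Theta S T))%:E | S in C] | T in D]).

Definition gapped (n j k : nat) : set 'M[K]_n :=
  [set B : 'M[K]_n | [/\ selfadjoint B, eigengap B j & eigengap B k]].

Definition sup_quotient (n : nat) (N : 'M[K]_n -> R) (dom : set 'M[K]_n)
    (f : 'M[K]_n -> set {vspace 'cV[K]_n}) (A : 'M[K]_n) (eps : R) : \bar R :=
  ereal_sup [set (hausdorff_dist N (f A) (f B) * ((N (A - B))^-1)%:E)%E |
             B in [set B | dom B /\ 0 < N (A - B) < eps]].

Definition condition_number (n : nat) (N : 'M[K]_n -> R) (dom : set 'M[K]_n)
    (f : 'M[K]_n -> set {vspace 'cV[K]_n}) (A : 'M[K]_n) : \bar R :=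
  lim (sup_quotient N dom f A eps @[eps --> 0^'+]).

End Definitions.

(* Main.v *)
Require Import Defs.
From HB Require Import structures.
From mathcomp Require Import all_boot all_order all_algebra.
From mathcomp Require Import perm complex.
From mathcomp Require Import all_classical all_reals all_analysis.
From mathcomp Require Import zify ring lra.
Import Order.TTheory GRing.Theory Num.Theory.
Import numFieldNormedType.Exports.
Local Open Scope classical_set_scope.
Local Open Scope ring_scope.

(**
  Write [X], [Y] (resp. [X'], [Y']) for the dominant eigenspaces of dimensions
  [j] and [k] of [A] (resp. [B]), and also for the orthogonal projections onto
  them. Let [S] satisfy [X <= S <= Y] and put [Z = Y - S]. The vectors of
  [Y' - X'] orthogonal to [Z] form a space of dimension at least
  [(k - j) - (k - h) = h - j]; take [W] of dimension [h - j] inside it and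
  [T = X' + W]. Then
    [(1 - S) T = (1 - Y) Y' T + Z (1 - X) X'],
  so [||sin Theta(S, T)|| <= ||sin Theta(X, X')|| + ||sin Theta(Y, Y')||]
  exactly, and the same construction produces [S] from a given [T]. The
  Davis-Kahan theorem bounds both terms by [||A - B||] over the gap between
  [lambda_l(B)] and [lambda_{l+1}(A)], and Weyl's inequality turns that gap into
  the gap of [A] as [B] tends to [A].
*)

Set Implicit Arguments.
Unset Strict Implicit.
Unset Printing Implicit Defensive.

(** [N] is known only through its axioms, so every estimate must come from unitary invariance and
    the triangle inequality. Projections and diagonal contractions are therefore written as averages
    of unitary matrices, and [sin Theta] is compared with [(1 - S) T] through Gram matrices: for
    equal dimensions both have the sines of the principal angles as singular values, up to zeros.

    The difficulty in choosing [T] is that it must contain [X'], lie in [Y'] and stay close to [S].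
    Orthogonality of [W] to [Z] removes the product [Z W] from [(1 - S) T]; what survives are the
    residuals of the two outer eigenspaces, multiplied only by projections, so each enters with the
    factor one.

    The factor one in Davis-Kahan rests on a one-sided separation: the top [l] eigenvalues of [B]
    all lie above the remaining eigenvalues of [A]. Since [N] is not normalised, Weyl's inequality
    carries the factor [N (pid_mx 1)]; it only rescales the loss of gap, which tends to zero with
    [eps]. *)

Section Scalars.
Context (R : realType) (F : scalar_kind).
Local Notation K := (scalar_field R F).
Local Notation re := (@of_real R F).
Local Notation conj := (@conj_scalar R F).

(** * Real and complex scalars treated uniformly *)

Lemma conj_scalar_is_zmod_morphism : zmod_morphism conj.
Proof. by case: F => // x y; exact: (rmorphB (@Num.conj R[i])). Qed.

Lemma conj_scalar_is_monoid_morphism : monoid_morphism conj.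
Proof. by case: F; split=> //; [exact: (rmorph1 (@Num.conj R[i]))
                       | exact: (rmorphM (@Num.conj R[i]))]. Qed.

HB.instance Definition _ :=
  GRing.isZmodMorphism.Build K K conj conj_scalar_is_zmod_morphism.
HB.instance Definition _ :=
  GRing.isMonoidMorphism.Build K K conj conj_scalar_is_monoid_morphism.

Lemma of_real_is_zmod_morphism : zmod_morphism re.
Proof. by case: F => // x y; exact: (rmorphB (real_complex R)). Qed.

Lemma of_real_is_monoid_morphism : monoid_morphism re.
Proof. by case: F; split=> //; exact: (rmorphM (real_complex R)). Qed.

HB.instance Definition _ :=
  GRing.isZmodMorphism.Build R K re of_real_is_zmod_morphism.
HB.instance Definition _ :=
  GRing.isMonoidMorphism.Build R K re of_real_is_monoid_morphism.

Lemma conj_scalarK : involutive conj.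
Proof. by case: F => // x /=; rewrite conjCK. Qed.

Lemma conj_scalar_of_real x : conj (re x) = re x.
Proof. by case: F => //=; apply: conj_Creal; rewrite complex_real. Qed.

Lemma of_real_le x y : (re x <= re y) = (x <= y).
Proof. by case: F => //=; rewrite lecR. Qed.

Lemma of_real_norm x : `|re x| = re `|x|.
Proof. by case: F => //=; rewrite normc_def /= expr0n addr0 sqrtr_sqr. Qed.

Lemma scalar_sqr_norm (x : K) : `|x| ^+ 2 = conj x * x.
Proof.
by case: F x => x /=; rewrite ?normCKC // real_normK ?num_real // expr2.
Qed.

(** In the order of [R[i]] comparability with [0] already forces the imaginary part to vanish. *)
Lemma of_real_ge0P (x : K) : 0 <= x -> exists2 r, 0 <= r & x = re r.
Proof.
case: F x => x /=; first by exists x.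
case: x => a b; rewrite lecE /= => /andP[/eqP -> a0].
by exists a.
Qed.

Lemma conj_fixed_of_real (x : K) : conj x = x -> exists r, x = re r.
Proof.
case: F x => x /=; first by exists x.
by move=> /CrealP /complex_realP.
Qed.

End Scalars.

(** * Adjoints, orthonormal systems and orthogonal projections *)

Section Adjoint.
Context (R : realType) (F : scalar_kind).
Local Notation K := (scalar_field R F).
Local Notation re := (@of_real R F).
Local Notation conj := (@conj_scalar R F).
Implicit Types m n p q r : nat.

Lemma adjointE p q (M : 'M[K]_(p, q)) i j : adjoint M i j = conj (M j i).
Proof. by rewrite !mxE. Qed.

Lemma adjointK p q (M : 'M[K]_(p, q)) : adjoint (adjoint M) = M.
Proof. by apply/matrixP=> i j; rewrite !adjointE conj_scalarK. Qed.

Lemma adjointM p q r (M : 'M[K]_(p, q)) (M' : 'M[K]_(q, r)) :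
  adjoint (M *m M') = adjoint M' *m adjoint M.
Proof. by rewrite /adjoint trmx_mul map_mxM. Qed.

Lemma adjointD p q (M M' : 'M[K]_(p, q)) :
  adjoint (M + M') = adjoint M + adjoint M'.
Proof. by rewrite /adjoint linearD map_mxD. Qed.

Lemma adjointB p q (M M' : 'M[K]_(p, q)) :
  adjoint (M - M') = adjoint M - adjoint M'.
Proof. by rewrite /adjoint linearB map_mxB. Qed.

Lemma adjoint0 p q : adjoint (0 : 'M[K]_(p, q)) = 0.
Proof. by rewrite /adjoint trmx0 map_mx0. Qed.

Lemma adjoint1 n : adjoint (1%:M : 'M[K]_n) = 1%:M.
Proof. by rewrite /adjoint trmx1 map_mx1. Qed.

Lemma adjoint_of_realZ p q (a : R) (M : 'M[K]_(p, q)) :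
  adjoint (re a *: M) = re a *: adjoint M.
Proof. by apply/matrixP=> i j; rewrite !mxE rmorphM /= conj_scalar_of_real. Qed.

Lemma adjoint_pid_mx p q r :
  adjoint (pid_mx r : 'M[K]_(p, q)) = pid_mx r.
Proof. by rewrite /adjoint tr_pid_mx map_pid_mx. Qed.

Lemma adjoint_row_mx p q r (M : 'M[K]_(p, q)) (M' : 'M[K]_(p, r)) :
  adjoint (row_mx M M') = col_mx (adjoint M) (adjoint M').
Proof. by rewrite /adjoint tr_row_mx map_col_mx. Qed.

Lemma gram_diagE p q (M : 'M[K]_(p, q)) j :
  (adjoint M *m M) j j = \sum_i `|M i j| ^+ 2.
Proof. by rewrite mxE; apply: eq_bigr=> i _; rewrite adjointE -scalar_sqr_norm. Qed.

Lemma gram_eq0 p q (M : 'M[K]_(p, q)) : adjoint M *m M = 0 -> M = 0.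
Proof.
move=> M0; apply/matrixP=> i j; rewrite mxE.
have /eqP := gram_diagE M j; rewrite M0 mxE eq_sym.
rewrite psumr_eq0 => [|k _]; last by rewrite exprn_ge0.
by move=> /allP /(_ i (mem_index_enum _)) /=; rewrite expf_eq0 normr_eq0 => /eqP.
Qed.

Lemma gram_cV_gt0 n (v : 'cV[K]_n) : v != 0 ->
  exists2 a, 0 < a & adjoint v *m v = (re a)%:M.
Proof.
move=> v0.
have /of_real_ge0P[a a0 va] : 0 <= (adjoint v *m v) 0 0.
  by rewrite gram_diagE sumr_ge0 // => i _; rewrite exprn_ge0.
exists a; last by rewrite [LHS]mx11_scalar va.
rewrite lt_def a0 andbT; apply: contra v0 => /eqP a00.
by apply/eqP/gram_eq0; rewrite [LHS]mx11_scalar va a00 rmorph0 raddf0.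
Qed.

Lemma orthonormal_cols_normalize n (v : 'cV[K]_n) : v != 0 ->
  exists2 a, 0 < a & orthonormal_cols (re a *: v).
Proof.
move=> /gram_cV_gt0[a a0 va]; exists (Num.sqrt a)^-1; first by rewrite invr_gt0 sqrtr_gt0.
rewrite /orthonormal_cols adjoint_of_realZ -scalemxAl -scalemxAr va.
rewrite !scale_scalar_mx -!rmorphM -{3}[a]sqr_sqrtr ?ltW // mulrA -expr2.
by rewrite -exprMn mulVf ?expr1n ?rmorph1 // gt_eqF // sqrtr_gt0.
Qed.

Lemma orthonormal_row_mx n p q (V : 'M[K]_(n, p)) (W : 'M[K]_(n, q)) :
  orthonormal_cols V -> orthonormal_cols W -> adjoint V *m W = 0 ->
  orthonormal_cols (row_mx V W).
Proof.
rewrite /orthonormal_cols => V1 W1 VW; rewrite adjoint_row_mx mul_col_row V1 W1 VW.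
have -> : adjoint W *m V = 0 by rewrite -[_ *m _]adjointK adjointM adjointK VW adjoint0.
by rewrite -scalar_mx_block.
Qed.

Lemma mul_row_mx_adjoint n p q (V : 'M[K]_(n, p)) (W : 'M[K]_(n, q)) :
  row_mx V W *m adjoint (row_mx V W) = V *m adjoint V + W *m adjoint W.
Proof. by rewrite adjoint_row_mx mul_row_col. Qed.

(** All dimension counts pass through this lemma and its variants: lying in the range of a
    projection [P] is the constraint [1%:M - P], being orthogonal to the columns of [V] is the
    constraint [adjoint V]. The induction stacks the vectors already found under [M] and normalises
    one more kernel vector. *)
Lemma exists_orthonormal_kernel p q r (M : 'M[K]_(p, q)) :
  (\rank M + r <= q)%N ->
  exists V : 'M[K]_(q, r), orthonormal_cols V /\ M *m V = 0.
Proof.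
elim: r => [|r IHr] rq.
  by exists 0; split; [apply/matrixP=> [[]] | rewrite mulmx0].
have [|V [V1 MV]] := IHr; first by rewrite (leq_trans _ rq) // leq_add2l.
pose A := col_mx M (adjoint V).
have : cokermx A != 0.
  rewrite -mxrank_eq0 mxrank_coker -lt0n subn_gt0.
  have -> : \rank A = \rank (M + adjoint V)%MS by rewrite addsmxE.
  apply: leq_ltn_trans (mxrank_adds_leqif _ _) _.
  rewrite (leq_trans _ rq) // addnS ltnS leq_add2l rank_leq_row //.
case/matrix0Pn=> i [j Aij].
pose v := col j (cokermx A).
have v0 : v != 0 by apply/matrix0Pn; exists i, 0; rewrite mxE.
have : A *m v = 0 by rewrite /v colE mulmxA mulmx_coker mul0mx.
rewrite mul_col_mx -col_mx0 => /eq_col_mx[Mv Vv].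
have [a a0 v1] := orthonormal_cols_normalize v0.
exists (row_mx (re a *: v) V); split; last first.
  have := mul_mx_row M (re a *: v) V.
  by rewrite -scalemxAr Mv MV scaler0 row_mx0.
apply: (orthonormal_row_mx v1 V1).
by rewrite -[LHS]adjointK adjointM adjointK -scalemxAr Vv scaler0 adjoint0.
Qed.

Lemma exists_orthonormal_kernel2 p1 p2 q r (M1 : 'M[K]_(p1, q)) (M2 : 'M[K]_(p2, q)) :
  (\rank M1 + \rank M2 + r <= q)%N ->
  exists V : 'M[K]_(q, r), [/\ orthonormal_cols V, M1 *m V = 0 & M2 *m V = 0].
Proof.
move=> rq; have [|V [V1]] := @exists_orthonormal_kernel _ q r (col_mx M1 M2).
  have -> : \rank (col_mx M1 M2) = \rank (M1 + M2)%MS by rewrite addsmxE.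
  by apply: leq_trans rq; rewrite leq_add2r mxrank_adds_leqif.
by rewrite mul_col_mx -col_mx0 => /eq_col_mx[]; exists V.
Qed.

Lemma exists_orthonormal_kernel3 p1 p2 p3 q r (M1 : 'M[K]_(p1, q))
    (M2 : 'M[K]_(p2, q)) (M3 : 'M[K]_(p3, q)) :
  (\rank M1 + \rank M2 + \rank M3 + r <= q)%N ->
  exists V : 'M[K]_(q, r),
    [/\ orthonormal_cols V, M1 *m V = 0, M2 *m V = 0 & M3 *m V = 0].
Proof.
move=> rq; have [|V [V1 M12 M3V]] := @exists_orthonormal_kernel2 _ _ q r (col_mx M1 M2) M3.
  have -> : \rank (col_mx M1 M2) = \rank (M1 + M2)%MS by rewrite addsmxE.
  by apply: leq_trans rq; rewrite !leq_add2r mxrank_adds_leqif.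
by move: M12; rewrite mul_col_mx -col_mx0 => /eq_col_mx[]; exists V.
Qed.

Lemma mul_adjoint_eq0C m n p (V : 'M[K]_(n, m)) (W : 'M[K]_(n, p)) :
  adjoint V *m W = 0 -> adjoint W *m V = 0.
Proof. by move=> VW; rewrite -[LHS]adjointK adjointM adjointK VW adjoint0. Qed.

Lemma orthonormal_sqr_unitary n (V : 'M[K]_n) : orthonormal_cols V -> unitary V.
Proof. by move=> V1; split=> //; apply: mulmx1C. Qed.

Lemma unitary1 n : unitary (1%:M : 'M[K]_n).
Proof. by split; rewrite adjoint1 mulmx1. Qed.

Lemma unitary_adjoint n (U : 'M[K]_n) : unitary U -> unitary (adjoint U).
Proof. by case=> U1 U2; split; rewrite adjointK. Qed.

Lemma orthonormal_mul m n p (V : 'M[K]_(m, n)) (W : 'M[K]_(n, p)) :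
  orthonormal_cols V -> orthonormal_cols W -> orthonormal_cols (V *m W).
Proof.
by rewrite /orthonormal_cols => V1 W1; rewrite adjointM mulmxA -(mulmxA _ _ V) V1 mulmx1.
Qed.

Lemma orthonormal_rank n l (V : 'M[K]_(n, l)) : orthonormal_cols V -> \rank V = l.
Proof.
move=> V1; apply/eqP; rewrite eqn_leq rank_leq_col.
by rewrite -{1}(mxrank1 K l) -V1 mxrankM_maxr.
Qed.

Lemma rank_compl_proj n l (V : 'M[K]_(n, l)) : orthonormal_cols V ->
  (\rank (1%:M - V *m adjoint V)%R + l <= n)%N.
Proof.
move=> V1; have := @mulmx0_rank_max K _ _ _ (1%:M - V *m adjoint V) V.
rewrite (orthonormal_rank V1); apply.
by rewrite mulmxBl mul1mx -mulmxA V1 mulmx1 subrr.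
Qed.

(** An inclusion between ranges of equal dimension is an equality: [adjoint V *m V'] is then a
    square isometry, hence unitary, and cancels in [V' *m adjoint V']. *)
Lemma proj_unique n l l' (V : 'M[K]_(n, l)) (V' : 'M[K]_(n, l')) :
  l = l' -> orthonormal_cols V -> orthonormal_cols V' ->
  V *m adjoint V *m V' = V' -> V' *m adjoint V' = V *m adjoint V.
Proof.
move=> ll; subst l' => V1 V1' VV.
pose M := adjoint V *m V'; have VM : V *m M = V' by rewrite mulmxA.
have M1 : M *m adjoint M = 1%:M.
  by apply: mulmx1C; rewrite {1}/M adjointM adjointK -mulmxA VM V1'.
by rewrite -VM adjointM mulmxA -(mulmxA V) M1 mulmx1.
Qed.

Lemma orthonormal_proj_mul0 n l m (V : 'M[K]_(n, l)) (W : 'M[K]_(n, m)) :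
  orthonormal_cols V -> V *m adjoint V *m W = 0 -> adjoint V *m W = 0.
Proof. by move=> V1 VW; rewrite -[LHS]mul1mx -V1 -!mulmxA (mulmxA V) VW mulmx0. Qed.

Lemma orthonormal_proj_mul_id n l m (V : 'M[K]_(n, l)) (P : 'M[K]_(m, n)) Q :
  orthonormal_cols V -> P *m (V *m adjoint V) = Q *m adjoint V -> P *m V = Q.
Proof.
move=> V1 PV; rewrite -[LHS]mulmx1 -V1 mulmxA -(mulmxA P) PV.
by rewrite -mulmxA V1 mulmx1.
Qed.

Lemma compl_proj_mul0 n m (P : 'M[K]_n) (W : 'M[K]_(n, m)) :
  (1%:M - P) *m W = 0 -> P *m W = W.
Proof. by move=> PW; apply/eqP; rewrite -subr_eq0 -opprB -{1}[W]mul1mx -mulmxBl PW oppr0. Qed.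

Lemma orthonormal_pair_complete n p q (V : 'M[K]_(n, p)) (W : 'M[K]_(n, q)) :
  n = (p + q)%N -> orthonormal_cols V -> orthonormal_cols W ->
  adjoint V *m W = 0 -> V *m adjoint V + W *m adjoint W = 1%:M.
Proof.
move=> npq V1 W1 VW; rewrite -mul_row_mx_adjoint.
have := @proj_unique n n (p + q) 1%:M (row_mx V W).
rewrite adjoint1 !mul1mx; apply=> //; first exact: (unitary1 n).1.
exact: orthonormal_row_mx.
Qed.

Lemma orthonormal_complement n l (V : 'M[K]_(n, l)) : orthonormal_cols V ->
  exists W : 'M[K]_(n, n - l), [/\ orthonormal_cols W, adjoint V *m W = 0 &
    V *m adjoint V + W *m adjoint W = 1%:M].
Proof.
move=> V1; have ln : (l <= n)%N by rewrite -(orthonormal_rank V1) rank_leq_row.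
have [|W [W1 VW]] := @exists_orthonormal_kernel l n (n - l) (adjoint V).
  by rewrite -[leqRHS](subnKC ln) leq_add2r rank_leq_row.
by exists W; split=> //; apply: orthonormal_pair_complete; rewrite // subnKC.
Qed.

End Adjoint.

(** * Gram matrices and real diagonal matrices *)

Section GramAndSpectral.
Context (R : realType) (F : scalar_kind).
Local Notation K := (scalar_field R F).
Local Notation re := (@of_real R F).
Implicit Types m n p q r : nat.

Lemma mxrank_adjoint p q (M : 'M[K]_(p, q)) : \rank (adjoint M) = \rank M.
Proof. by rewrite /adjoint mxrank_map mxrank_tr. Qed.

(** This takes the place of a singular value decomposition: a unitarily invariant norm sees a matrix
    only up to unitary factors, so norms can be compared through Gram matrices. [V] is an
    orthonormal basis of the range of [Q], [B] a right inverse of the coordinates [C], and [Q' *m B]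
    the orthonormal system to which [V] is sent; the two orthogonal complements have equal dimension
    and are matched arbitrarily. *)
Lemma gram_eq_unitary n m (Q Q' : 'M[K]_(n, m)) :
  adjoint Q *m Q = adjoint Q' *m Q' -> exists2 U, unitary U & Q' = U *m Q.
Proof.
move=> QQ; have rn := rank_leq_row Q; have [r rE] : exists r, r = \rank Q by exists (\rank Q).
rewrite -rE in rn.
have [|W [W1 QW]] := @exists_orthonormal_kernel R F m n (n - r) (adjoint Q).
  by rewrite mxrank_adjoint -rE subnKC.
have WQ : adjoint W *m Q = 0.
  by rewrite -[LHS]adjointK adjointM adjointK QW adjoint0.
have [V [V1 WV VV1]] := orthonormal_complement W1.
have QV : Q = V *m (adjoint V *m Q).
  by rewrite -[LHS]mul1mx -VV1 mulmxDl -!mulmxA WQ mulmx0 add0r.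
have [C CE] : exists C, C = adjoint V *m Q by eexists.
rewrite -CE in QV.
have /row_freeP[B CB] : row_free C.
  rewrite /row_free eqn_leq rank_leq_row /=; apply: (@leq_trans r).
    by rewrite subKn.
  by rewrite [leqLHS]rE [X in (\rank X <= _)%N]QV mxrankM_maxr.
have QB : Q *m B = V by rewrite QV -mulmxA CB mulmx1.
have [V' V'E] : exists V', V' = Q' *m B by eexists.
have V'1 : orthonormal_cols V'.
  rewrite /orthonormal_cols V'E adjointM mulmxA -(mulmxA _ _ Q') -QQ mulmxA -adjointM.
  by rewrite -mulmxA QB.
(* [Q] annihilates [1%:M - B *m C], and [Q'] has the same kernel as [Q] because their Gram matrices
   agree. *)
have Q'E : Q' = V' *m C.
  apply/eqP; rewrite -subr_eq0; apply/eqP/gram_eq0.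
  have -> : Q' - V' *m C = Q' *m (1%:M - B *m C).
    by rewrite mulmxBr mulmx1 mulmxA V'E.
  rewrite adjointM mulmxA -(mulmxA _ _ Q') -QQ -!mulmxA.
  by rewrite [Q *m _]mulmxBr mulmx1 (mulmxA Q) QB -QV subrr !mulmx0.
have [|W' [W'1 V'W']] := @exists_orthonormal_kernel R F _ n (n - r) (adjoint V').
  by rewrite mxrank_adjoint (orthonormal_rank V'1) subKn // subnKC.
have W'V' : adjoint W' *m V' = 0.
  by rewrite -[LHS]adjointK adjointM adjointK V'W' adjoint0.
exists (V' *m adjoint V + W' *m adjoint W).
  apply: orthonormal_sqr_unitary; rewrite /orthonormal_cols adjointD !adjointM !adjointK.
  rewrite mulmxDr !mulmxDl !mulmxA -(mulmxA V _ V') V'1 -(mulmxA W _ V') W'V'.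
  rewrite -(mulmxA V _ W') V'W' -(mulmxA W _ W') W'1.
  by rewrite !mulmx1 !mulmx0 !mul0mx addr0 add0r addrC VV1.
by rewrite mulmxDl -!mulmxA WQ mulmx0 addr0 -CE.
Qed.

(** The diagonal is a function on [nat], so that [pid_mx] and [copid_mx] become indicator diagonals
    and products of diagonals are pointwise. *)
Definition real_diag n (d : nat -> R) : 'M[K]_n :=
  diag_mx (\row_(i < n) re (d i)).

Lemma real_diagE n d i j : real_diag n d i j = re (d i) *+ (i == j).
Proof. by rewrite !mxE. Qed.

Lemma eq_real_diag n d e : (forall i, (i < n)%N -> d i = e i) ->
  real_diag n d = real_diag n e.
Proof.
move=> de; apply/matrixP=> i j; rewrite !real_diagE.
by rewrite de // ltn_ord.
Qed.

Lemma adjoint_real_diag n d : adjoint (real_diag n d) = real_diag n d.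
Proof.
apply/matrixP=> i j; rewrite adjointE !real_diagE rmorphMn /= conj_scalar_of_real.
by rewrite eq_sym; case: eqP => [->|].
Qed.

Lemma mul_real_diag n d e :
  real_diag n d *m real_diag n e = real_diag n (fun i => d i * e i).
Proof.
by rewrite mulmx_diag; congr diag_mx; apply/rowP=> i; rewrite !mxE rmorphM.
Qed.

Lemma mul_real_diag_mxE n m d (M : 'M[K]_(n, m)) i j :
  (real_diag n d *m M) i j = re (d i) * M i j.
Proof. by rewrite mul_diag_mx !mxE. Qed.

Lemma mul_mx_real_diagE n m d (M : 'M[K]_(m, n)) i j :
  (M *m real_diag n d) i j = M i j * re (d j).
Proof. by rewrite mul_mx_diag !mxE. Qed.

Lemma pid_mx_real_diag n r :
  pid_mx r = real_diag n (fun i => (i < r)%N%:R).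
Proof.
by apply/matrixP=> i j; rewrite real_diagE mxE rmorph_nat -mulrnA mulnb andbC.
Qed.

Lemma copid_mx_real_diag n r :
  copid_mx r = real_diag n (fun i => (r <= i)%N%:R).
Proof.
apply/matrixP=> i j; rewrite real_diagE !mxE rmorph_nat -mulrnA mulnb (leqNgt r).
by rewrite (inj_eq val_inj); case: (i < r)%N; case: (i == j); rewrite /= ?subrr ?subr0.
Qed.

Lemma selfadjoint_eigenvalue n (M : 'M[K]_n) mu (v : 'rV[K]_n) :
  selfadjoint M -> v *m M = mu *: v -> v != 0 -> exists a, mu = re a.
Proof.
move=> Msa vM v0; apply: conj_fixed_of_real.
have w0 : adjoint v != 0 by apply: contra v0 => /eqP E; rewrite -[v]adjointK E adjoint0.
have [a a0] := gram_cV_gt0 w0; rewrite adjointK => va.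
have : adjoint (v *m M *m adjoint v) = v *m M *m adjoint v.
  by rewrite !adjointM adjointK -Msa mulmxA.
rewrite vM -scalemxAl va => /matrixP/(_ 0 0); rewrite adjointE !mxE mulr1n.
rewrite rmorphM /= conj_scalar_of_real; apply: mulIf.
by rewrite fmorph_eq0 gt_eqF.
Qed.

End GramAndSpectral.

(** * Spectral theorem and ordered eigenvalues *)

Lemma complex_exists_eigenvalue (R : realType) n
    (M : 'M[scalar_field R ComplexScalars]_n) :
  (0 < n)%N -> exists mu, eigenvalue M mu.
Proof.
move=> n0; have /(@closed_rootP R[i]) : size (char_poly M) != 1.
  by rewrite size_char_poly; case: (n) n0.
by case=> mu rmu; exists mu; rewrite eigenvalue_root_char.
Qed.

(** The real case passes through the complexification: an eigenvalue there is real by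
    self-adjointness, and being a root of the characteristic polynomial descends to [R]. *)
Lemma selfadjoint_exists_eigenvalue (R : realType) F n
    (M : 'M[scalar_field R F]_n) :
  (0 < n)%N -> selfadjoint M -> exists r, eigenvalue M (of_real F r).
Proof.
move=> n0; case: F M => M Msa; last first.
  have [mu /[dup] Mmu /eigenvalueP[v vM v0]] := complex_exists_eigenvalue M n0.
  by have [r mur] := selfadjoint_eigenvalue Msa vM v0; exists r; rewrite -mur.
pose MC : 'M[scalar_field R ComplexScalars]_n := map_mx (real_complex R) M.
have MCsa : selfadjoint MC.
  apply/matrixP=> i j; rewrite adjointE !mxE (@conj_scalar_of_real R ComplexScalars).
  by have /matrixP/(_ i j) := Msa; rewrite adjointE /= => ->.
have [mu /[dup] Mmu /eigenvalueP[v vM v0]] := complex_exists_eigenvalue MC n0.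
have [r mur] := selfadjoint_eigenvalue MCsa vM v0; exists r.
move: Mmu; rewrite mur !eigenvalue_root_char.
by rewrite -(map_char_poly (real_complex R)) fmorph_root.
Qed.

Section Spectral.
Context (R : realType) (F : scalar_kind).
Local Notation K := (scalar_field R F).
Local Notation re := (@of_real R F).
Local Notation real_diag := (@real_diag R F).
Implicit Types m n p q : nat.

Lemma selfadjoint_exists_eigenvector n (M : 'M[K]_n) :
  (0 < n)%N -> selfadjoint M ->
  exists r (v : 'cV[K]_n), orthonormal_cols v /\ M *m v = re r *: v.
Proof.
move=> n0 Msa; have [r /eigenvalueP[v vM v0]] := selfadjoint_exists_eigenvalue n0 Msa.
have w0 : adjoint v != 0 by apply: contra v0 => /eqP E; rewrite -[v]adjointK E adjoint0.
have [a a0 w1] := orthonormal_cols_normalize w0.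
exists r, (re a *: adjoint v); split=> //.
rewrite -scalemxAr {1}Msa -adjointM vM adjoint_of_realZ.
by rewrite scalerA mulrC -scalerA.
Qed.

(** Deflation: the orthogonal complement of the eigenvectors found so far is invariant because [A]
    is self-adjoint, so an eigenvector of the compression to it is an eigenvector of [A]. *)
Lemma partial_eigenbasis n (A : 'M[K]_n) l : selfadjoint A -> (l <= n)%N ->
  exists (V : 'M[K]_(n, l)) d, orthonormal_cols V /\ A *m V = V *m real_diag l d.
Proof.
move=> Asa; elim: l => [|l IHl] ln.
  by exists 0, (fun=> 0); split; [apply/matrixP=> [[]] | rewrite mulmx0 mul0mx].
have [V [d [V1 AV]]] := IHl (ltnW ln).
have [W [W1 VW VW1]] := orthonormal_complement V1.
have Msa : selfadjoint (adjoint W *m A *m W).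
  by rewrite /selfadjoint !adjointM adjointK -Asa mulmxA.
have [|r [y [y1 My]]] := selfadjoint_exists_eigenvector _ Msa.
  by rewrite subn_gt0.
have VAW : adjoint V *m A *m W = 0.
  by rewrite [A in X in X *m W]Asa -adjointM AV adjointM -mulmxA VW mulmx0.
have Av : A *m (W *m y) = re r *: (W *m y).
  have VAWy : adjoint V *m (A *m (W *m y)) = 0 by rewrite !mulmxA VAW mul0mx.
  have WAWy : adjoint W *m (A *m (W *m y)) = re r *: y by rewrite !mulmxA My.
  by rewrite -[LHS]mul1mx -VW1 mulmxDl -!mulmxA VAWy WAWy mulmx0 add0r scalemxAr.
exists (row_mx (W *m y) V), (fun i => if i is i'.+1 then d i' else r); split.
  apply: (orthonormal_row_mx (orthonormal_mul W1 y1) V1).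
  by rewrite adjointM -mulmxA -[X in _ *m X]adjointK adjointM adjointK VW adjoint0 mulmx0.
have := mul_mx_row A (W *m y) V; rewrite Av AV => ->.
apply/matrixP=> i j; rewrite mul_mx_real_diagE !mxE.
case: (@splitP 1 l j) => k jk; first by rewrite jk ord1 !mxE mulrC.
by rewrite mul_mx_real_diagE jk.
Qed.

Lemma selfadjoint_eigenbasis n (A : 'M[K]_n) : selfadjoint A ->
  exists (U : 'M[K]_n) d, unitary U /\ A *m U = U *m real_diag n d.
Proof.
move=> Asa; have [V [d [V1 AV]]] := partial_eigenbasis Asa (leqnn n).
by exists V, d; split=> //; apply: orthonormal_sqr_unitary.
Qed.

Lemma char_poly_eigenbasis n (A U : 'M[K]_n) d :
  unitary U -> A *m U = U *m real_diag n d ->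
  char_poly A = \prod_(x <- mkseq d n) ('X - (re x)%:P).
Proof.
case=> U1 U2 AU; have UP : map_mx polyC U *m map_mx polyC (adjoint U) = 1%:M.
  by rewrite -map_mxM U2 map_mx1.
have -> : A = U *m real_diag n d *m adjoint U by rewrite -AU -mulmxA U2 mulmx1.
transitivity (char_poly (real_diag n d)).
  rewrite /char_poly /char_poly_mx !map_mxM /=.
  have XE : 'X%:M = map_mx polyC U *m 'X%:M *m map_mx polyC (adjoint U).
    by rewrite mul_mx_scalar -scalemxAl UP scalemx1.
  rewrite [in LHS]XE.
  by rewrite -mulmxBl -mulmxBr !det_mulmx mulrC mulrA -det_mulmx (mulmx1C UP) det1 mul1r.
rewrite char_poly_trig ?diag_mx_is_trig // big_map.
rewrite -[iota 0 n](val_enum_ord n) big_map big_enum /=.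
by apply: eq_bigr => i _; rewrite real_diagE eqxx.
Qed.

Section Eigenvalues.
Context (n : nat) (B : 'M[K]_n) (Bsa : selfadjoint B).

Lemma eigenvaluesP : sorted >=%R (eigenvalues B) /\
  char_poly B = \prod_(x <- eigenvalues B) ('X - (re x)%:P).
Proof.
have [U [d [U1 BU]]] := selfadjoint_eigenbasis Bsa.
suff /(xgetPex [::]) : exists s, [set s : seq R | sorted >=%R s /\
    char_poly B = \prod_(x <- s) ('X - (re x)%:P)] s by [].
exists (sort >=%R (mkseq d n)); split; first by apply: sort_sorted => x y; apply: le_total.
rewrite (char_poly_eigenbasis U1 BU); apply: perm_big.
by rewrite perm_sym perm_sort.
Qed.

Lemma perm_eigenvalues (U : 'M[K]_n) d :
  unitary U -> B *m U = U *m real_diag n d -> perm_eq (eigenvalues B) (mkseq d n).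
Proof.
move=> U1 /(char_poly_eigenbasis U1); rewrite eigenvaluesP.2.
rewrite -!(big_map re xpredT (fun x => 'X - x%:P)) => /prod_XsubC_eq.
by move/(perm_map_inj (fmorph_inj _)).
Qed.

Lemma size_eigenvalues : size (eigenvalues B) = n.
Proof.
have [U [d [U1 BU]]] := selfadjoint_eigenbasis Bsa.
by rewrite (perm_size (perm_eigenvalues U1 BU)) size_mkseq.
Qed.

Lemma eigval_le i j : (0 < i)%N -> (i <= j)%N -> (j <= n)%N -> eigval B j <= eigval B i.
Proof.
case: i j => // i [//|j] _ ij jn; rewrite /eigval /=.
apply: (sorted_leq_nth _ _ 0 eigenvaluesP.1); rewrite ?inE ?size_eigenvalues //.
- by move=> x y z xy yz; apply: le_trans yz xy.
- by move=> x; apply: lexx.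
- exact: leq_trans ij jn.
Qed.

Lemma sorted_eigenbasis : exists U : 'M[K]_n,
  unitary U /\ B *m U = U *m real_diag n (fun i => eigval B i.+1).
Proof.
have [U [d [U1 BU]]] := selfadjoint_eigenbasis Bsa.
have := perm_eigenvalues U1 BU.
have -> : mkseq d n = [tuple d i | i < n].
  by rewrite /= /mkseq -val_enum_ord -map_comp.
case/tuple_permP=> p Ep.
have Ed (i : 'I_n) : eigval B i.+1 = d (p i).
  by rewrite /eigval /= Ep -tnth_nth !tnth_mktuple.
exists (U *m perm_mx p^-1); split.
  split; rewrite /adjoint trmx_mul tr_perm_mx map_mxM map_perm_mx invgK.
    by rewrite mulmxA -(mulmxA (perm_mx _)) U1.1 mulmx1 -perm_mxM mulgV perm_mx1.
  by rewrite mulmxA -(mulmxA U) -perm_mxM mulVg perm_mx1 mulmx1 U1.2.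
rewrite mulmxA BU -!mulmxA; congr (U *m _).
apply/matrixP=> i j; rewrite mul_real_diag_mxE mul_mx_real_diagE Ed !mxE.
by case: eqP => [<-|]; rewrite ?mulr0 ?mul0r // permKV mulr1 mul1r.
Qed.

End Eigenvalues.
End Spectral.

(** * Subspaces as column spans of orthonormal matrices *)

Section Subspaces.
Context (R : realType) (F : scalar_kind).
Local Notation K := (scalar_field R F).
Local Notation real_diag := (@real_diag R F).
Implicit Types n p q l : nat.

Lemma eq_cols p q (M M' : 'M[K]_(p, q)) :
  (forall j, col j M = col j M') -> M = M'.
Proof.
move=> MM'; apply/matrixP=> i j.
by have /matrixP/(_ i 0) := MM' j; rewrite !mxE.
Qed.

Lemma memv_colspanP n l (V : 'M[K]_(n, l)) v :
  reflect (exists c : 'cV_l, v = V *m c) (v \in colspan V).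
Proof.
have sumE (c : 'I_l -> K) :
    V *m (\col_i c i) = \sum_i c i *: [tuple col i V | i < l]`_i.
  apply/matrixP=> i j; rewrite summxE !mxE; apply: eq_bigr => m _.
  by rewrite -tnth_nth tnth_mktuple !mxE mulrC.
apply: (iffP idP) => [/coord_span ->|[c ->]]; first by eexists; rewrite -sumE.
have -> : c = \col_i c i 0 by apply/matrixP=> i j; rewrite ord1 mxE.
rewrite sumE rpred_sum // => i _; apply/rpredZ/memv_span.
by rewrite -tnth_nth mem_tnth.
Qed.

Lemma col_memv_colspan n l (V : 'M[K]_(n, l)) i : col i V \in colspan V.
Proof. by apply/memv_colspanP; exists (delta_mx i 0); rewrite colE. Qed.

Lemma colspan_subvP n l m (V : 'M[K]_(n, l)) (W : 'M[K]_(n, m)) :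
  orthonormal_cols V ->
  (colspan W <= colspan V)%VS <-> V *m adjoint V *m W = W.
Proof.
move=> V1; split=> [/subvP WV|VW].
  apply: eq_cols => i; rewrite !colE -!mulmxA -colE.
  have /WV /memv_colspanP[c ->] := col_memv_colspan W i.
  by rewrite mulmxA -(mulmxA V) (mulmxA _ V) V1 mul1mx.
apply/subvP=> v /memv_colspanP[c ->]; apply/memv_colspanP.
by exists (adjoint V *m W *m c); rewrite !mulmxA VW.
Qed.

Lemma dim_colspan n l (V : 'M[K]_(n, l)) : orthonormal_cols V -> \dim (colspan V) = l.
Proof.
move=> V1; have : free [tuple col i V | i < l].
  apply/freeP => c c0 i; have : V *m (\col_i c i) = 0.
    rewrite -[RHS]c0; apply/matrixP=> a b; rewrite summxE !mxE.
    by apply: eq_bigr => m _; rewrite -tnth_nth tnth_mktuple !mxE mulrC.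
  move=> /(congr1 (mulmx (adjoint V))); rewrite mulmxA V1 mul1mx mulmx0.
  by move=> /matrixP/(_ i 0); rewrite !mxE.
by rewrite /free size_tuple => /eqP.
Qed.

Lemma eq_colspan n l (V W : 'M[K]_(n, l)) :
  orthonormal_cols V -> orthonormal_cols W ->
  V *m adjoint V *m W = W -> colspan V = colspan W.
Proof.
move=> V1 W1 VW; apply/esym/eqP; rewrite eqEdim !dim_colspan // leqnn andbT.
exact/colspan_subvP.
Qed.

Lemma orthonormal_basisP n (S : {vspace 'cV[K]_n}) :
  orthonormal_cols (orthonormal_basis S) /\ colspan (orthonormal_basis S) = S.
Proof.
suff /(xgetPex 0) : exists V : 'M[K]_(n, \dim S),
  [set V : 'M[K]_(n, \dim S) | orthonormal_cols V /\ colspan V = S] V by [].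
pose E : 'M[K]_(n, \dim S) := \matrix_(i, j) (vbasis S)`_j i 0.
have SE : colspan E = S.
  rewrite -[RHS](span_basis (vbasisP S)) /colspan.
  apply: (congr1 (fun t : (\dim S).-tuple 'cV[K]_n => <<t>>%VS)).
  apply: eq_from_tnth => i; rewrite tnth_mktuple; apply/matrixP=> a b.
  by rewrite ord1 !mxE (tnth_nth 0).
have Sn : (\dim S <= n)%N.
  by have := dimvS (subvf S); rewrite dimvf /dim /= muln1.
(* The orthonormal basis comes from taking the orthogonal complement twice: [W] is orthogonal to
   [S], [V] is orthogonal to [W], and the dimensions force [V] to span [S]. *)
have [|W [W1 EW]] := @exists_orthonormal_kernel R F _ n (n - \dim S) (adjoint E).
  by rewrite -[leqRHS](subnKC Sn) leq_add2r rank_leq_row.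
have [|V [V1 WV]] := @exists_orthonormal_kernel R F _ n (\dim S) (adjoint W).
  by rewrite -[leqRHS](subnK Sn) leq_add2r rank_leq_row.
exists V; split=> //; apply/esym/eqP; rewrite eqEdim dim_colspan // leqnn andbT.
rewrite -{1}SE; apply/colspan_subvP => //.
rewrite -[RHS]mul1mx -(orthonormal_pair_complete _ W1 V1 WV) ?subnK //.
rewrite mulmxDl -(mulmxA W) -[adjoint W *m E]adjointK adjointM adjointK EW.
by rewrite adjoint0 mulmx0 add0r.
Qed.

End Subspaces.

(** * Dominant eigenspaces as spectral projections *)

Section DominantEigenspace.
Context (R : realType) (F : scalar_kind).
Local Notation K := (scalar_field R F).
Local Notation re := (@of_real R F).
Local Notation real_diag := (@real_diag R F).
Context (n : nat).
Implicit Types (G : 'M[K]_n).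

Definition top_cols l G : 'M[K]_(n, l) := G *m pid_mx l.

(** In the basis [G] this projection and its complement are [pid_mx l] and [copid_mx l], which turns
    spectral statements into statements about coordinates. *)
Definition top_proj l G : 'M[K]_n := G *m pid_mx l *m adjoint G.

Lemma orthonormal_top_cols l G :
  (l <= n)%N -> unitary G -> orthonormal_cols (top_cols l G).
Proof.
move=> ln [G1 _]; apply: orthonormal_mul => //.
rewrite /orthonormal_cols adjoint_pid_mx mul_pid_mx.
by rewrite minnn (minn_idPr ln) pid_mx_1.
Qed.

Lemma top_colsK l G : (l <= n)%N -> top_cols l G *m adjoint (top_cols l G) = top_proj l G.
Proof.
move=> ln; rewrite /top_cols adjointM adjoint_pid_mx mulmxA -(mulmxA G).
by rewrite mul_pid_mx !minnn.
Qed.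

Lemma adjoint_top_proj l G : adjoint (top_proj l G) = top_proj l G.
Proof. by rewrite /top_proj !adjointM adjointK adjoint_pid_mx mulmxA. Qed.

Lemma top_proj_mul l m G : (l <= m)%N -> (m <= n)%N -> unitary G ->
  top_proj m G *m top_proj l G = top_proj l G.
Proof.
move=> lm mn [G1 _]; rewrite /top_proj !mulmxA -(mulmxA _ _ G) G1 mulmx1.
by rewrite -(mulmxA G) mul_pid_mx (minn_idPr lm) (minn_idPr (leq_trans lm mn)).
Qed.

Lemma top_proj_compl l G : unitary G ->
  1%:M - top_proj l G = G *m copid_mx l *m adjoint G.
Proof. by case=> _ G1; rewrite /copid_mx mulmxBr mulmx1 mulmxBl G1. Qed.

Lemma rank_top_proj l G : (l <= n)%N -> (\rank (top_proj l G) <= l)%N.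
Proof.
move=> ln; rewrite (leq_trans (mxrankM_maxl _ _)) //.
by rewrite (leq_trans (mxrankM_maxr _ _)) // rank_pid_mx.
Qed.

Lemma rank_top_proj_compl l G : unitary G -> (l <= n)%N ->
  (\rank (1%:M - top_proj l G)%R <= n - l)%N.
Proof.
move=> G1 ln; rewrite top_proj_compl // (leq_trans (mxrankM_maxl _ _)) //.
by rewrite (leq_trans (mxrankM_maxr _ _)) // rank_copid_mx.
Qed.

Lemma dominant_eigenspaceE l (B G : 'M[K]_n) : selfadjoint B -> unitary G ->
  B *m G = G *m real_diag n (fun i => eigval B i.+1) -> (l <= n)%N ->
  eigengap B l -> dominant_eigenspace l B = colspan (top_cols l G).
Proof.
move=> Bsa G1 BG ln gap.
have T1 := orthonormal_top_cols ln G1.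
have BT (i : 'I_l) : B *m col i (top_cols l G) = re (eigval B i.+1) *: col i (top_cols l G).
  rewrite colE /top_cols -mulmxA mulmxA BG -!mulmxA.
  rewrite scalemxAr; congr (G *m _); apply/matrixP=> a b.
  rewrite mul_real_diag_mxE -colE !mxE; case: eqP => [->//|]; by rewrite !mulr0.
have : exists X : {vspace 'cV[K]_n}, [set X : {vspace 'cV[K]_n} | exists V : 'M[K]_(n, l),
    [/\ orthonormal_cols V, forall i : 'I_l,
          B *m col i V = of_real F (eigval B i.+1) *: col i V & X = colspan V]] X.
  by exists (colspan (top_cols l G)), (top_cols l G).
move=> /(xgetPex 0%VS)[V [V1 BV XE]]; apply: (etrans XE).
apply/esym/eq_colspan => //; rewrite top_colsK //.
apply: eq_cols => i; rewrite colE -mulmxA -colE.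
set v := col i V; have GB : adjoint G *m B = real_diag n (fun i => eigval B i.+1) *m adjoint G.
  rewrite -[LHS]adjointK adjointM adjointK -Bsa BG adjointM adjoint_real_diag.
  by [].
(* A nonzero coordinate of [v] at an index [a] with [l <= a] would make [eigval B a.+1] equal to
   [eigval B i.+1] with [i < l]; by monotonicity this closes the gap at [l]. *)
have copv : copid_mx l *m (adjoint G *m v) = 0.
  have : adjoint G *m (B *m v) = adjoint G *m (B *m v) by [].
  rewrite {2}BV mulmxA GB -mulmxA -scalemxAr => E.
  apply/matrixP=> a b; have := congr1 (fun M : 'cV[K]_n => M a b) E.
  rewrite copid_mx_real_diag !mul_real_diag_mxE !mxE.
  case: leqP => la; rewrite ?rmorph0 ?mul0r // => /eqP.
  rewrite -subr_eq0 -mulrBl mulf_eq0 -rmorphB fmorph_eq0 subr_eq0.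
  case/orP => [/eqP Eab|/eqP ->]; last by rewrite mulr0.
  have l0 : (0 < l)%N := leq_ltn_trans (leq0n _) (ltn_ord i).
  move: gap; rewrite /eigengap /lambda /= gtn_eqF // lte_fin ltNge => /negP[].
  have := eigval_le Bsa (ltn0Sn i) (ltn_ord i) ln.
  move=> /le_trans; apply; rewrite -Eab; exact: eigval_le.
have -> : top_proj l G = 1%:M - G *m copid_mx l *m adjoint G.
  by rewrite -top_proj_compl // opprB addrC subrK.
by rewrite mulmxBl mul1mx -!mulmxA copv mulmx0 subr0.
Qed.

End DominantEigenspace.

(** * Contraction properties of unitarily invariant norms *)

Section UnitarilyInvariantNorm.
Context (R : realType) (F : scalar_kind).
Local Notation K := (scalar_field R F).
Local Notation re := (@of_real R F).
Local Notation real_diag := (@real_diag R F).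
Context (n : nat) (N : 'M[K]_n -> R) (hN : unitarily_invariant_norm N).
Implicit Types (M : 'M[K]_n) (d : nat -> R).

Lemma uinorm_real_scale (a : R) M : N (re a *: M) = `|a| * N M.
Proof.
case: hN => _ Nscale _ _; apply: (fmorph_inj (@of_real R F)).
by rewrite rmorphM /= Nscale of_real_norm.
Qed.

Lemma uinorm_triangle M M' : N (M + M') <= N M + N M'.
Proof. by case: hN. Qed.

Lemma uinorm0 : N 0 = 0.
Proof. by rewrite -(scale0r 0) -(rmorph0 re) uinorm_real_scale normr0 mul0r. Qed.

Lemma uinormN M : N (- M) = N M.
Proof.
by rewrite -scaleN1r -(rmorphN1 re) uinorm_real_scale normrN normr1 mul1r.
Qed.

Lemma uinorm_ge0 M : 0 <= N M.
Proof.
have := uinorm_triangle M (- M); rewrite subrr uinorm0 uinormN.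
by rewrite -mulr2n pmulrn_lge0.
Qed.

Lemma uinorm_gt0 M : M != 0 -> 0 < N M.
Proof.
move=> M0; rewrite lt_def uinorm_ge0 andbT; apply: contra M0 => /eqP.
by case: hN => N0 _ _ _ /N0 ->.
Qed.

Lemma uinorm_unitaryl U M : unitary U -> N (U *m M) = N M.
Proof.
case: hN => _ _ _ inv U1.
by rewrite -[U *m M]mulmx1 inv //; apply: unitary1.
Qed.

Lemma uinorm_unitaryr U M : unitary U -> N (M *m U) = N M.
Proof.
case: hN => _ _ _ inv U1.
by rewrite -[M]mul1mx -mulmxA (mulmxA 1%:M) inv ?mul1mx //; apply: unitary1.
Qed.

Lemma unitary_reflection l (V : 'M[K]_(n, l)) : orthonormal_cols V ->
  unitary (2%:R *: (V *m adjoint V) - 1%:M).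
Proof.
move=> V1; have P2 : V *m adjoint V *m (V *m adjoint V) = V *m adjoint V.
  by rewrite mulmxA -(mulmxA V) V1 mulmx1.
apply: orthonormal_sqr_unitary; rewrite /orthonormal_cols adjointB adjoint1.
rewrite -(rmorph_nat re) adjoint_of_realZ adjointM adjointK !rmorph_nat.
rewrite mulmxBl mul1mx mulmxBr mulmx1 -scalemxAl -scalemxAr P2.
by rewrite [_ *: (_ *: _)]scaler_nat mulr2n addrK opprB addrC subrK.
Qed.

(** A projection [P] is the average of the identity and the reflection [2 P - 1], which is
    unitary. *)
Lemma uinorm_projl l (V : 'M[K]_(n, l)) M : orthonormal_cols V ->
  N (V *m adjoint V *m M) <= N M.
Proof.
move=> V1; have -> : V *m adjoint V *m M =
    re 2^-1 *: (M + (2%:R *: (V *m adjoint V) - 1%:M) *m M).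
  rewrite mulmxBl mul1mx addrC subrK -scalemxAl scalerA fmorphV rmorph_nat.
  by rewrite mulVf ?scale1r // pnatr_eq0.
rewrite uinorm_real_scale ger0_norm ?invr_ge0 // ler_pdivrMl //.
rewrite (le_trans (uinorm_triangle _ _)) //.
by rewrite uinorm_unitaryl ?mulr2n ?mulrDl ?mul1r //; apply: unitary_reflection.
Qed.

Lemma uinorm_projr l (V : 'M[K]_(n, l)) M : orthonormal_cols V ->
  N (M *m (V *m adjoint V)) <= N M.
Proof.
move=> V1; have -> : M *m (V *m adjoint V) =
    re 2^-1 *: (M + M *m (2%:R *: (V *m adjoint V) - 1%:M)).
  rewrite mulmxBr mulmx1 addrC subrK -scalemxAr scalerA fmorphV rmorph_nat.
  by rewrite mulVf ?scale1r // pnatr_eq0.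
rewrite uinorm_real_scale ger0_norm ?invr_ge0 // ler_pdivrMl //.
rewrite (le_trans (uinorm_triangle _ _)) //.
by rewrite uinorm_unitaryr ?mulr2n ?mulrDl ?mul1r //; apply: unitary_reflection.
Qed.

(* A diagonal contraction is a convex combination of diagonal sign matrices. *)
Lemma uinorm_diag_convex (L M : 'M[K]_n) d b :
  (forall e, (forall i, (e i == 1) || (e i == -1)) ->
    N (L *m real_diag n e *m M) <= b) ->
  (forall i, (i < n)%N -> `|d i| <= 1) -> N (L *m real_diag n d *m M) <= b.
Proof.
move=> signs dle1.
suff main m e : (forall i, `|e i| <= 1) ->
    (forall i, (m <= i)%N -> (e i == 1) || (e i == -1)) ->
    N (L *m real_diag n e *m M) <= b.
  (* Entries at indices from [n] on do not occur in the matrix; setting them to [1] lets the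
     induction start at [m = n]. *)
  rewrite (@eq_real_diag _ _ _ d (fun i => if (i < n)%N then d i else 1)).
    by apply: (main n) => i; case: ltnP => // *; rewrite ?normr1 ?eqxx // dle1.
  by move=> i ->.
elim: m e => [|m IHm] e ele1 esign; first by apply: signs => i; apply: esign.
pose flip (x : R) i := if i == m then x else e i.
have flip_bound x : (x == 1) || (x == -1) -> N (L *m real_diag n (flip x) *m M) <= b.
  move=> xsign; apply: IHm => i; rewrite /flip.
    by case: eqP => // _; case/orP: xsign => /eqP ->; rewrite ?normrN normr1.
  case: (eqVneq i m) => [//|im mi]; apply: esign.
  by rewrite ltn_neqAle eq_sym im.
have -> : real_diag n e = re ((1 + e m) / 2) *: real_diag n (flip 1) +
                          re ((1 - e m) / 2) *: real_diag n (flip (-1)).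
  apply/matrixP=> i j; rewrite !mxE /flip !mulrnAr -mulrnDl -!rmorphM -rmorphD.
  by congr (re _ *+ _); case: eqP => [->|_]; lra.
have := ele1 m; rewrite ler_norml => /andP[em1 em2].
rewrite mulmxDr mulmxDl -!scalemxAr -!scalemxAl (le_trans (uinorm_triangle _ _)) //.
rewrite !uinorm_real_scale !ger0_norm; [|lra|lra].
have b1 : N (L *m real_diag n (flip 1) *m M) <= b by apply: flip_bound; rewrite eqxx.
have b2 : N (L *m real_diag n (flip (-1)) *m M) <= b.
  by apply: flip_bound; rewrite eqxx orbT.
have -> : b = (1 + e m) / 2 * b + (1 - e m) / 2 * b by lra.
by apply: lerD; apply: ler_wpM2l => //; lra.
Qed.

Lemma unitary_sign_diag (e : nat -> R) : (forall i, (e i == 1) || (e i == -1)) ->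
  unitary (real_diag n e).
Proof.
move=> esign; apply: orthonormal_sqr_unitary.
rewrite /orthonormal_cols adjoint_real_diag mul_real_diag.
apply/matrixP=> i j; rewrite real_diagE mxE.
have -> : e i * e i = 1 by case/orP: (esign i) => /eqP ->; rewrite ?mulrNN mulr1.
by rewrite rmorph1.
Qed.

Lemma real_diag_scale d r : (forall i, (i < n)%N -> `|d i| <= r) ->
  real_diag n d = re r *: real_diag n (fun i => d i / r).
Proof.
move=> dr; apply/matrixP=> i j; rewrite !mxE mulrnAr -rmorphM; congr (re _ *+ _).
(* If [r = 0] then [d] vanishes on the relevant indices, so dividing by [r] does no harm. *)
have [r0|r0] := eqVneq r 0; last by rewrite mulrC divfK.
by have := dr i (ltn_ord i); rewrite r0 mul0r normr_le0 => /eqP.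
Qed.

Lemma div_bound_le1 d r : (forall i, (i < n)%N -> `|d i| <= r) ->
  forall i, (i < n)%N -> `|d i / r| <= 1.
Proof.
move=> dr i ni; have r0 : 0 <= r := le_trans (normr_ge0 _) (dr i ni).
rewrite normrM normfV (ger0_norm r0).
have [->|rn0] := eqVneq r 0; first by rewrite invr0 mulr0.
by rewrite ler_pdivrMr ?mul1r ?dr // lt_def rn0.
Qed.

Lemma uinorm_diagl d r M : (0 < n)%N -> (forall i, (i < n)%N -> `|d i| <= r) ->
  N (real_diag n d *m M) <= r * N M.
Proof.
move=> n0 dr; have r0 : 0 <= r := le_trans (normr_ge0 _) (dr 0%N n0).
rewrite (real_diag_scale dr) -scalemxAl uinorm_real_scale (ger0_norm r0).
apply: ler_wpM2l => //; rewrite -[X in X *m M]mul1mx.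
apply: uinorm_diag_convex; last exact: div_bound_le1.
by move=> e esign; rewrite mul1mx uinorm_unitaryl //; apply: unitary_sign_diag.
Qed.

Lemma uinorm_diagr d r M : (0 < n)%N -> (forall i, (i < n)%N -> `|d i| <= r) ->
  N (M *m real_diag n d) <= r * N M.
Proof.
move=> n0 dr; have r0 : 0 <= r := le_trans (normr_ge0 _) (dr 0%N n0).
rewrite (real_diag_scale dr) -scalemxAr uinorm_real_scale (ger0_norm r0).
apply: ler_wpM2l => //; rewrite -[X in N X]mulmx1.
apply: uinorm_diag_convex; last exact: div_bound_le1.
by move=> e esign; rewrite mulmx1 uinorm_unitaryr //; apply: unitary_sign_diag.
Qed.

End UnitarilyInvariantNorm.

(** * Principal angles and residuals of projections *)

Section SinTheta.
Context (R : realType) (F : scalar_kind).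
Local Notation K := (scalar_field R F).
Local Notation re := (@of_real R F).
Local Notation real_diag := (@real_diag R F).
Context (n : nat) (N : 'M[K]_n -> R) (hN : unitarily_invariant_norm N).

Lemma pad_real_diag q d : (q <= n)%N ->
  (pid_mx q : 'M[K]_(n, q)) *m real_diag q d *m (pid_mx q : 'M[K]_(q, n)) =
  real_diag n (fun i => if (i < q)%N then d i else 0).
Proof.
move=> qn; apply/matrixP=> i j; rewrite real_diagE mxE.
under eq_bigr do rewrite mul_mx_real_diagE !mxE.
have [iq|qi] := ltnP i q; last first.
  rewrite rmorph0 mul0rn big1 // => m _.
  by rewrite andbF !mul0r.
rewrite (bigD1 (Ordinal iq)) //= big1 ?addr0 => [|m].
  by rewrite eqxx mul1r iq andbT -(inj_eq val_inj) /= mulr_natr.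
by rewrite -(inj_eq val_inj) /= eq_sym => /negPf ->; rewrite !mul0r.
Qed.

Lemma gram_real_diag_ge0 p q (M : 'M[K]_(p, q)) d i :
  adjoint M *m M = real_diag q d -> (i < q)%N -> 0 <= d i.
Proof.
move=> MM iq; rewrite -(@of_real_le R F) rmorph0.
have -> : re (d i) = (adjoint M *m M) (Ordinal iq) (Ordinal iq).
  by rewrite MM real_diagE eqxx.
by rewrite gram_diagE sumr_ge0 // => m _; rewrite exprn_ge0.
Qed.

(** In an eigenbasis [w] of the Gram matrix [H] of [adjoint VS *m VT], whose eigenvalues are the
    squared cosines, the vectors [(1%:M - PS) *m (VT *m w)] are orthogonal with squared lengths one
    minus these, the squared sines. Hence the residual and [sin_Theta S T] differ by unitary factors
    only. *)
Lemma uinorm_sin_Theta (S T : {vspace 'cV[K]_n}) (PS PT : 'M[K]_n) :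
  \dim S = \dim T ->
  PS = orthonormal_basis S *m adjoint (orthonormal_basis S) ->
  PT = orthonormal_basis T *m adjoint (orthonormal_basis T) ->
  N (sin_Theta S T) = N ((1%:M - PS) *m PT).
Proof.
move=> dST; rewrite /sin_Theta /principal_angles /singular_values.
move: (orthonormal_basisP S) (orthonormal_basisP T) => [+ _] [+ _].
move: (orthonormal_basis S) (orthonormal_basis T); move: dST.
move: (\dim S) (\dim T) => p q pq VS VT; subst p => VS1 VT1 -> -> {PS PT}.
have qn : (q <= n)%N by rewrite -(orthonormal_rank VT1) rank_leq_row.
set PS := VS *m adjoint VS.
pose H := adjoint (adjoint VS *m VT) *m (adjoint VS *m VT).
have Hsa : selfadjoint H by rewrite /selfadjoint adjointM adjointK.
have [w [[w1 w2] Hw]] := sorted_eigenbasis Hsa.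
set c2 := fun i => eigval H i.+1 in Hw.
pose K1 := (1%:M - PS) *m (VT *m w).
have PSsa : adjoint (1%:M - PS) = 1%:M - PS.
  by rewrite adjointB adjoint1 adjointM adjointK.
have PS2 : (1%:M - PS) *m (1%:M - PS) = 1%:M - PS.
  rewrite mulmxBr mulmx1 mulmxBl mul1mx {2}/PS mulmxA -(mulmxA VS) VS1 mulmx1.
  by rewrite subrr subr0.
have K1gram : adjoint K1 *m K1 = real_diag q (fun i => 1 - c2 i).
  rewrite adjointM PSsa mulmxA -(mulmxA (adjoint _)) PS2 mulmxBr mulmx1 mulmxBl.
  rewrite (orthonormal_mul VT1 w1).
  have -> : adjoint (VT *m w) *m PS *m (VT *m w) = adjoint w *m (H *m w).
    by rewrite /H /PS !adjointM adjointK !mulmxA.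
  rewrite Hw mulmxA w1 mul1mx; apply/matrixP=> i j.
  by rewrite !mxE rmorphB mulrnBl rmorph1.
have c2_ge0 i : (i < q)%N -> 0 <= c2 i.
  apply: (@gram_real_diag_ge0 _ _ (adjoint VS *m VT *m w)).
  by rewrite adjointM mulmxA -(mulmxA (adjoint w)) -/H -mulmxA Hw mulmxA w1 mul1mx.
have c2_le1 i : (i < q)%N -> c2 i <= 1.
  by move=> iq; rewrite -subr_ge0 (gram_real_diag_ge0 K1gram).
pose s i := nth 0 [seq sin t | t <- [seq acos x | x <-
  take (minn q q) [seq Num.sqrt x | x <- eigenvalues H]]] i.
have sE i : s i ^+ 2 = if (i < q)%N then 1 - c2 i else 0.
  rewrite /s minnn take_oversize ?size_map ?size_eigenvalues //.
  have [iq|qi] := ltnP i q; last first.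
    by rewrite nth_default ?expr0n // !size_map size_eigenvalues.
  have sz : size (eigenvalues H) = q := size_eigenvalues Hsa.
  rewrite !(nth_map 0) ?size_map ?sz // -/(c2 i).
  rewrite sin_acos; last first.
    rewrite (le_trans _ (sqrtr_ge0 _)) ?oppr_le0 //=.
    by rewrite -[leRHS]sqrtr1 ler_sqrt ?c2_le1.
  by rewrite (sqr_sqrtr (c2_ge0 _ iq)) sqr_sqrtr // subr_ge0 c2_le1.
(* [U1] completes the orthonormal columns [VT *m w] to a unitary matrix; multiplying by it turns the
   residual into [K1] padded with zero columns. *)
have [U1 U1u VTw] : exists2 U, unitary U & VT *m w = U *m (pid_mx q : 'M[K]_(n, q)).
  apply: gram_eq_unitary; rewrite (orthonormal_mul VT1 w1) adjoint_pid_mx mul_pid_mx.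
  by rewrite minnn (minn_idPr qn) pid_mx_1.
pose L := (1%:M - PS) *m (VT *m adjoint VT) *m U1.
have LE : L = K1 *m (pid_mx q : 'M[K]_(q, n)).
  rewrite /L; have -> : VT *m adjoint VT = (VT *m w) *m adjoint (VT *m w).
    by rewrite adjointM mulmxA -(mulmxA VT) w2 mulmx1.
  rewrite {2}VTw adjointM adjoint_pid_mx -!mulmxA U1u.1 mulmx1.
  by rewrite /K1 !mulmxA.
have [U Uu LU] : exists2 U, unitary U & L = U *m real_diag n s.
  apply: gram_eq_unitary; rewrite adjoint_real_diag mul_real_diag LE.
  rewrite adjointM adjoint_pid_mx mulmxA -(mulmxA (pid_mx q)) K1gram pad_real_diag //.
  by apply: eq_real_diag => i _; rewrite -expr2 sE.
have <- : N L = N ((1%:M - PS) *m (VT *m adjoint VT)) by apply: uinorm_unitaryr.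
by rewrite LU uinorm_unitaryl.
Qed.

End SinTheta.

(** * The Davis-Kahan and Weyl inequalities *)

Section Perturbation.
Context (R : realType) (F : scalar_kind).
Local Notation K := (scalar_field R F).
Local Notation re := (@of_real R F).
Local Notation real_diag := (@real_diag R F).
Context (n : nat) (N : 'M[K]_n -> R) (hN : unitarily_invariant_norm N).
Context (A B GA GB : 'M[K]_n) (Asa : selfadjoint A) (Bsa : selfadjoint B).
Hypothesis (GAu : unitary GA)
  (AGA : A *m GA = GA *m real_diag n (fun i => eigval A i.+1)).
Hypothesis (GBu : unitary GB)
  (BGB : B *m GB = GB *m real_diag n (fun i => eigval B i.+1)).

Lemma subr_mxE p q (P Q : 'M[K]_(p, q)) i j : (P - Q) i j = P i j - Q i j.
Proof. by rewrite !mxE. Qed.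

(* After diagonalisation, the off-diagonal block [Z] solves a Sylvester
   equation [X = DA Z - Z DB] with [N X <= N (A - B)]. Shifting by the smallest
   eigenvalue of [A] makes [DA] a contraction up to the factor [r] on the block
   and [DB] expanding by [r + delta], whence the constant 1. *)
Lemma davis_kahan l : (0 < l)%N -> (l < n)%N -> eigval A l.+1 < eigval B l ->
  N ((1%:M - top_proj l GA) *m top_proj l GB) <=
  N (A - B) / (eigval B l - eigval A l.+1).
Proof.
move=> l0 ln gap; have n0 : (0 < n)%N := ltn_trans l0 ln.
pose a i := eigval A i.+1; pose b i := eigval B i.+1; pose c := eigval A n.
pose M := adjoint GA *m GB.
pose Z : 'M[K]_n := copid_mx l *m M *m pid_mx l.
pose X : 'M[K]_n := copid_mx l *m (adjoint GA *m (A - B) *m GB) *m pid_mx l.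
have NZ : N ((1%:M - top_proj l GA) *m top_proj l GB) = N Z.
  rewrite top_proj_compl // /top_proj !mulmxA uinorm_unitaryr //; last exact: unitary_adjoint.
  by rewrite -!mulmxA uinorm_unitaryl // /Z /M !mulmxA.
have GAA : adjoint GA *m A = real_diag n a *m adjoint GA.
  by rewrite -[LHS]adjointK adjointM adjointK -Asa AGA adjointM adjoint_real_diag.
have XE : X = copid_mx l *m (real_diag n a *m M - M *m real_diag n b) *m pid_mx l.
  congr (_ *m _ *m _); rewrite [in LHS]mulmxBr [in LHS]mulmxBl GAA.
  by rewrite -(mulmxA _ B) BGB /M !mulmxA.
have NX : N X <= N (A - B).
  rewrite /X copid_mx_real_diag pid_mx_real_diag.
  rewrite (le_trans (uinorm_diagr hN (r := 1) _ n0 _)) //.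
    by move=> i _; rewrite normr_nat lern1 leq_b1.
  rewrite mul1r (le_trans (uinorm_diagl hN (r := 1) _ n0 _)) //.
    by move=> i _; rewrite normr_nat lern1 leq_b1.
  by rewrite mul1r uinorm_unitaryr // uinorm_unitaryl //; apply: unitary_adjoint.
have an i : (i < n)%N -> c <= a i by move=> ni; apply: eigval_le.
have r0 : 0 <= a l - c by rewrite subr_ge0 an.
pose Y := Z *m real_diag n (fun i => b i - c).
have YE : Y = real_diag n (fun i => (l <= i)%N%:R * (a i - c)) *m Z - X.
  rewrite XE /Y /Z copid_mx_real_diag pid_mx_real_diag; apply/matrixP=> i j.
  rewrite !(subr_mxE, mul_real_diag_mxE, mul_mx_real_diagE).
  case: (l <= i)%N; case: (j < l)%N;
    rewrite ?(rmorph0, rmorph1, rmorphB, rmorphM) ?(mul0r, mulr0, mul1r, mulr1, subrr) //.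
  ring.
have ZY : Z = Y *m real_diag n (fun i => (i < l)%N%:R / (b i - c)).
  rewrite /Y -mulmxA mul_real_diag /Z pid_mx_real_diag -[RHS]mulmxA mul_real_diag.
  congr (_ *m _); apply: eq_real_diag => i ni; case: ltnP => il; last by rewrite !mul0r.
  rewrite mul1r div1r mulfV // gt_eqF // subr_gt0.
  by rewrite (le_lt_trans (an l ln)) // (lt_le_trans gap) // eigval_le // ltnW.
have bl i : (i < l)%N -> eigval B l <= b i.
  by move=> il; rewrite eigval_le // ltnW.
have cl : 0 < eigval B l - c.
  by rewrite subr_gt0 (le_lt_trans (an l ln)).
have NZY : N Z <= (eigval B l - c)^-1 * N Y.
  rewrite [in N Z]ZY; apply: uinorm_diagr => // i ni.
  case: ltnP => il; last by rewrite mul0r normr0 invr_ge0 ltW.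
  have ci : 0 < b i - c by rewrite (lt_le_trans cl) // lerB // bl.
  rewrite mul1r ger0_norm; last by rewrite invr_ge0 ltW.
  by rewrite lef_pV2 ?posrE // lerB // bl.
have NY : N Y <= (a l - c) * N Z + N (A - B).
  rewrite YE (le_trans (uinorm_triangle hN _ _)) // uinormN // lerD //.
  apply: uinorm_diagl => // i ni.
  case: leqP => il; last by rewrite mul0r normr0.
  by rewrite mul1r ger0_norm ?subr_ge0 ?an // lerB // eigval_le.
(* Together the bounds read [(eigval B l - c) * N Z <= (a l - c) * N Z + N (A - B)], and the shift
   [c] cancels. *)
rewrite NZ ler_pdivlMr ?subr_gt0 //.
move: NZY; rewrite mulrC ler_pdivlMr // => NZY.
by move: (le_trans NZY NY); rewrite -/(a l); lra.
Qed.

Lemma quadratic_formE d (y : 'cV[K]_n) :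
  (adjoint y *m (real_diag n d *m y)) 0 0 = \sum_(i < n) re (d i) * `|y i 0| ^+ 2.
Proof.
rewrite mxE; apply: eq_bigr => i _.
by rewrite mul_real_diag_mxE adjointE scalar_sqr_norm mulrCA.
Qed.

Lemma quadratic_form_ge (d : nat -> R) t (y : 'cV[K]_n) : orthonormal_cols y ->
  (forall i : 'I_n, y i 0 != 0 -> t <= d i) ->
  re t <= (adjoint y *m (real_diag n d *m y)) 0 0.
Proof.
move=> y1 td; have y1E : \sum_i `|y i 0| ^+ 2 = 1 :> K.
  by rewrite -gram_diagE y1 mxE.
rewrite quadratic_formE -[re t]mulr1 -y1E mulr_sumr; apply: ler_sum => i _.
have [->|/td ti] := eqVneq (y i 0) 0; first by rewrite normr0 expr0n !mulr0.
by rewrite ler_wpM2r ?exprn_ge0 // of_real_le.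
Qed.

Lemma quadratic_form_le (d : nat -> R) t (y : 'cV[K]_n) : orthonormal_cols y ->
  (forall i : 'I_n, y i 0 != 0 -> d i <= t) ->
  (adjoint y *m (real_diag n d *m y)) 0 0 <= re t.
Proof.
move=> y1 td; have y1E : \sum_i `|y i 0| ^+ 2 = 1 :> K.
  by rewrite -gram_diagE y1 mxE.
rewrite quadratic_formE -[re t]mulr1 -y1E mulr_sumr; apply: ler_sum => i _.
have [->|/td ti] := eqVneq (y i 0) 0; first by rewrite normr0 expr0n !mulr0.
by rewrite ler_wpM2r ?exprn_ge0 // of_real_le.
Qed.

(** Every unit vector is a unitary image of the first basis vector. The common value measures [N]
    against the spectral norm in Weyl's inequality. *)
Lemma uinorm_rank_one (x : 'cV[K]_n) : orthonormal_cols x ->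
  N (x *m adjoint x) = N (pid_mx 1).
Proof.
move=> x1; have n0 : (0 < n)%N by rewrite -(orthonormal_rank x1) rank_leq_row.
have [|U Uu ->] := @gram_eq_unitary R F n 1 (pid_mx 1) x.
  by rewrite x1 adjoint_pid_mx mul_pid_mx minnn (minn_idPr n0) pid_mx_1.
rewrite adjointM adjoint_pid_mx mulmxA -(mulmxA U) mul_pid_mx !minnn.
by rewrite uinorm_unitaryr ?uinorm_unitaryl //; apply: unitary_adjoint.
Qed.

(** A unit vector [x] in the top [l] eigenspace of [A] and orthogonal to the top [l.-1] eigenspace
    of [B] satisfies [x* A x >= eigval A l] and [x* B x <= eigval B l]. Compressing [A - B] to the
    line of [x] gives a multiple of a rank-one projection, whose norm is at most [N (A - B)]. *)
Lemma weyl l : (0 < l)%N -> (l <= n)%N ->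
  eigval A l - eigval B l <= N (A - B) / N (pid_mx 1).
Proof.
move=> l0 ln; have n0 : (0 < n)%N := leq_trans l0 ln.
have l1n : (l.-1 <= n)%N := leq_trans (leq_pred l) ln.
have [|x [x1 xA xB]] := @exists_orthonormal_kernel2 R F _ _ n 1
    (1%:M - top_proj l GA) (top_proj l.-1 GB).
  rewrite (leq_trans (leq_add (leq_add (rank_top_proj_compl GAu ln)
    (rank_top_proj _ l1n)) (leqnn 1))) //.
  by rewrite -addnA addn1 prednK // subnK.
have yu : orthonormal_cols (adjoint GA *m x).
  by apply: orthonormal_mul => //; case: (unitary_adjoint GAu).
have zu : orthonormal_cols (adjoint GB *m x).
  by apply: orthonormal_mul => //; case: (unitary_adjoint GBu).
have AE : A = GA *m real_diag n (fun i => eigval A i.+1) *m adjoint GA.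
  by rewrite -AGA -mulmxA GAu.2 mulmx1.
have BE : B = GB *m real_diag n (fun i => eigval B i.+1) *m adjoint GB.
  by rewrite -BGB -mulmxA GBu.2 mulmx1.
have Age : re (eigval A l) <= (adjoint x *m (A *m x)) 0 0.
  rewrite [X in X *m x]AE -!mulmxA (mulmxA (adjoint x)).
  rewrite -[adjoint x *m GA]adjointK adjointM adjointK.
  apply: quadratic_form_ge => // i yi; apply: eigval_le => //.
  rewrite ltnNge; apply: contra yi => li; apply/eqP.
  have : copid_mx l *m (adjoint GA *m x) = 0.
    rewrite -[LHS]mul1mx -GAu.1 -mulmxA (mulmxA GA) (mulmxA (GA *m _)) -top_proj_compl //.
    by rewrite xA mulmx0.
  move=> /matrixP/(_ i 0); rewrite copid_mx_real_diag mul_real_diag_mxE li rmorph1 mul1r.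
  by rewrite [in RHS]mxE.
have Bge : (adjoint x *m (B *m x)) 0 0 <= re (eigval B l).
  rewrite [X in X *m x]BE -!mulmxA (mulmxA (adjoint x)).
  rewrite -[adjoint x *m GB]adjointK adjointM adjointK.
  apply: quadratic_form_le => // i zi; apply: eigval_le => //.
  rewrite -(prednK l0) ltnS leqNgt; apply: contra zi => il; apply/eqP.
  have : (pid_mx l.-1 : 'M[K]_n) *m (adjoint GB *m x) = 0.
    by rewrite -[LHS]mul1mx -GBu.1 -mulmxA (mulmxA GB) (mulmxA (GB *m _)) xB mulmx0.
  move=> /matrixP/(_ i 0); rewrite pid_mx_real_diag mul_real_diag_mxE il rmorph1 mul1r.
  by rewrite [in RHS]mxE.
set q := (adjoint x *m ((A - B) *m x)) 0 0.
have qge : re (eigval A l - eigval B l) <= q.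
  by rewrite /q mulmxBl mulmxBr !mxE rmorphB lerB //; move: Age Bge; rewrite !mxE.
have pid0 : 0 < N (pid_mx 1).
  apply: uinorm_gt0 => //; apply/matrix0Pn; exists (Ordinal n0), (Ordinal n0).
  by rewrite mxE eqxx oner_eq0.
rewrite ler_pdivlMr // -(@of_real_le R F) rmorphM.
have qnorm : `|q| * re (N (pid_mx 1)) <= re (N (A - B)).
  case: (hN) => _ Nscale _ _; rewrite -(uinorm_rank_one x1) -Nscale of_real_le.
  have -> : q *: (x *m adjoint x) = x *m adjoint x *m ((A - B) *m (x *m adjoint x)).
    have -> : x *m adjoint x *m ((A - B) *m (x *m adjoint x)) =
        x *m (adjoint x *m ((A - B) *m x) *m adjoint x) by rewrite !mulmxA.
    by rewrite [adjoint x *m (_ *m x)]mx11_scalar -/q mul_scalar_mx scalemxAr.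
  by rewrite (le_trans (uinorm_projl hN _ x1)) // uinorm_projr.
apply: le_trans qnorm; apply: ler_wpM2r.
  by rewrite -(rmorph0 re) of_real_le ltW.
apply: (le_trans qge); apply: real_ler_norm.
(* Over [R[i]] the number [q] is real because it lies above a real number. *)
rewrite (ger_real qge) realE -(rmorph0 re) !of_real_le.
exact: num_real.
Qed.

End Perturbation.

(** * Matching admissible subspaces, with [d = h - j] and [e = k - h] *)

Section AdmissibleProjections.
Context (R : realType) (F : scalar_kind).
Local Notation K := (scalar_field R F).
Context (n j d e : nat).
Local Notation h := (j + d)%N.
Local Notation k := (j + d + e)%N.
Hypothesis kn : (k <= n)%N.
Let jn : (j <= n)%N := leq_trans (leq_trans (leq_addr d j) (leq_addr e _)) kn.
Let jk : (j <= k)%N := leq_trans (leq_addr d j) (leq_addr e _).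

(** For orthogonal projections the two inclusions of subspaces are product identities; the witness
    [V] fixes the rank. *)
Definition adm_proj (G P : 'M[K]_n) : Prop := exists V : 'M[K]_(n, h),
  [/\ orthonormal_cols V, P = V *m adjoint V,
      top_proj k G *m P = P & P *m top_proj j G = top_proj j G].

Context (N : 'M[K]_n -> R) (hN : unitarily_invariant_norm N).
Context (GA GB : 'M[K]_n) (GAu : unitary GA) (GBu : unitary GB).
Local Notation X := (top_proj j GA).
Local Notation Y := (top_proj k GA).
Local Notation X' := (top_proj j GB).
Local Notation Y' := (top_proj k GB).

(* Since [1 - P = (1 - Y) + Z Z*] and [Z] is orthogonal to [W] and to [X], one has
   [(1 - P) P' = (1 - Y) Y' P' + Z Z* (1 - X) X']. *)
Lemma uinorm_adm_proj (P P' : 'M[K]_n) (V' : 'M[K]_(n, h))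
    (Z : 'M[K]_(n, e)) (W : 'M[K]_(n, d)) :
  orthonormal_cols V' -> P' = V' *m adjoint V' -> orthonormal_cols Z ->
  P + Z *m adjoint Z = Y -> P' = X' + W *m adjoint W ->
  adjoint Z *m W = 0 -> adjoint Z *m X = 0 -> Y' *m P' = P' ->
  N ((1%:M - P) *m P') <=
    N ((1%:M - X) *m X') + N ((1%:M - Y) *m Y').
Proof.
move=> V'1 P'E Z1 PZ P'W ZW ZX Y'P'.
have -> : (1%:M - P) *m P' =
    Z *m adjoint Z *m ((1%:M - X) *m X') + (1%:M - Y) *m Y' *m P'.
  have -> : 1%:M - P = Z *m adjoint Z + (1%:M - Y).
    by rewrite -PZ opprD (addrA 1%:M) [RHS]addrC subrK.
  rewrite mulmxDl -[_ *m Y' *m P']mulmxA Y'P'; congr (_ + _).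
  have ZZX : Z *m adjoint Z *m (1%:M - X) = Z *m adjoint Z.
    by rewrite mulmxBr mulmx1 -mulmxA ZX mulmx0 subr0.
  have ZZW : Z *m adjoint Z *m (W *m adjoint W) = 0.
    by rewrite mulmxA -(mulmxA Z) ZW mulmx0 mul0mx.
  by rewrite (mulmxA _ (1%:M - X)) ZZX P'W mulmxDr ZZW addr0.
rewrite (le_trans (uinorm_triangle hN _ _)) // lerD //.
  exact: uinorm_projl.
by rewrite P'E; apply: uinorm_projr.
Qed.

Lemma top_proj_split (G : 'M[K]_n) (V : 'M[K]_(n, h)) (Z : 'M[K]_(n, e)) :
  unitary G -> orthonormal_cols V -> orthonormal_cols Z -> adjoint V *m Z = 0 ->
  top_proj k G *m V = V -> top_proj k G *m Z = Z ->
  V *m adjoint V + Z *m adjoint Z = top_proj k G.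
Proof.
move=> Gu V1 Z1 VZ YV YZ; rewrite -mul_row_mx_adjoint -(top_colsK _ kn).
apply: proj_unique => //; first exact: orthonormal_top_cols.
  exact: orthonormal_row_mx.
by rewrite top_colsK // mul_mx_row YV YZ.
Qed.

Lemma adm_proj_nearr (P : 'M[K]_n) : adm_proj GA P ->
  exists2 P', adm_proj GB P' & N ((1%:M - P) *m P') <=
    N ((1%:M - X) *m X') + N ((1%:M - Y) *m Y').
Proof.
case=> V [V1 PE YP PX].
have YV : Y *m V = V.
  by apply: orthonormal_proj_mul_id => //; rewrite -PE.
have rY : (\rank (1%:M - Y)%R <= n - k)%N by apply: rank_top_proj_compl.
have rY' : (\rank (1%:M - Y')%R <= n - k)%N by apply: rank_top_proj_compl.
have [|Z [Z1 VZ YZ]] := @exists_orthonormal_kernel2 R F _ _ n e (adjoint V) (1%:M - Y).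
  by rewrite (leq_trans (leq_add (leq_add (rank_leq_row _) rY) (leqnn e))) //; lia.
move/compl_proj_mul0 in YZ.
have PZ : P + Z *m adjoint Z = Y by rewrite PE; apply: top_proj_split.
have ZX : adjoint Z *m X = 0.
  by rewrite -PX PE !mulmxA (mul_adjoint_eq0C VZ) !mul0mx.
(* The three constraints have ranks at most [e], [n - k] and [j], with sum [n - d]. *)
have [|W [W1 ZW Y'W X'W]] := @exists_orthonormal_kernel3 R F _ _ _ n d (adjoint Z) (1%:M - Y') X'.
  rewrite (leq_trans (leq_add (leq_add (leq_add (rank_leq_row _) rY')
    (rank_top_proj _ jn)) (leqnn d))) //; lia.
move/compl_proj_mul0 in Y'W.
have T1 := orthonormal_top_cols jn GBu.
have TW : adjoint (top_cols j GB) *m W = 0.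
  by apply: orthonormal_proj_mul0 => //; rewrite top_colsK.
have V'1 := orthonormal_row_mx T1 W1 TW.
set V' := row_mx _ _ in V'1.
have P'E : V' *m adjoint V' = X' + W *m adjoint W by rewrite mul_row_mx_adjoint top_colsK.
have Y'P' : Y' *m (V' *m adjoint V') = V' *m adjoint V'.
  by rewrite P'E mulmxDr top_proj_mul // mulmxA Y'W.
exists (V' *m adjoint V'); last exact: (uinorm_adm_proj V'1 _ Z1 PZ P'E ZW ZX).
exists V'; split=> //; rewrite P'E mulmxDl top_proj_mul //.
rewrite -mulmxA -[adjoint W *m _]adjointK adjointM adjoint_top_proj adjointK X'W.
by rewrite adjoint0 mulmx0 addr0.
Qed.

(** Now [W] is given as the part of [P'] off [X']; [Z] is chosen in [Y] orthogonal to [W] and [X],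
    and [P] projects onto the complement of [Z] in [Y]. The residual is again [(1%:M - P) *m P'], so
    both halves of the Hausdorff distance rest on the same two Davis-Kahan bounds. *)
Lemma adm_proj_nearl (P' : 'M[K]_n) : adm_proj GB P' ->
  exists2 P, adm_proj GA P & N ((1%:M - P) *m P') <=
    N ((1%:M - X) *m X') + N ((1%:M - Y) *m Y').
Proof.
case=> V' [V'1 P'E Y'P' P'X'].
have rY : (\rank (1%:M - Y)%R <= n - k)%N by apply: rank_top_proj_compl.
have rP' : (\rank (1%:M - P')%R + h <= n)%N by rewrite P'E; apply: rank_compl_proj.
have [|W [W1 P'W X'W]] := @exists_orthonormal_kernel2 R F _ _ n d (1%:M - P') X'.
  rewrite (leq_trans _ rP') // -addnA leq_add2l leq_add2r; exact: rank_top_proj.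
move/compl_proj_mul0 in P'W.
have T1 := orthonormal_top_cols jn GBu.
have TW : adjoint (top_cols j GB) *m W = 0.
  by apply: orthonormal_proj_mul0 => //; rewrite top_colsK.
have P'T : P' *m top_cols j GB = top_cols j GB.
  by apply: orthonormal_proj_mul_id => //; rewrite top_colsK.
have P'XW : P' = X' + W *m adjoint W.
  rewrite -(top_colsK GB jn) -mul_row_mx_adjoint P'E; apply/esym/proj_unique => //.
    exact: orthonormal_row_mx.
  by rewrite -P'E mul_mx_row P'T P'W.
have [|Z [Z1 WZ YZ XZ]] := @exists_orthonormal_kernel3 R F _ _ _ n e (adjoint W) (1%:M - Y) X.
  rewrite (leq_trans (leq_add (leq_add (leq_add (rank_leq_row _) rY)
    (rank_top_proj _ jn)) (leqnn e))) //; lia.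
move/compl_proj_mul0 in YZ.
have [|V [V1 ZV YV]] := @exists_orthonormal_kernel2 R F _ _ n h (adjoint Z) (1%:M - Y).
  rewrite (leq_trans (leq_add (leq_add (rank_leq_row _) rY) (leqnn h))) //; lia.
move/compl_proj_mul0 in YV.
have PZ : V *m adjoint V + Z *m adjoint Z = Y.
  by apply: top_proj_split => //; apply: mul_adjoint_eq0C.
have ZX : adjoint Z *m X = 0.
  by rewrite -[LHS]adjointK adjointM adjoint_top_proj adjointK XZ adjoint0.
exists (V *m adjoint V); last first.
  exact: (uinorm_adm_proj V'1 P'E Z1 PZ P'XW (mul_adjoint_eq0C WZ) ZX).
exists V; split=> //; first by rewrite mulmxA YV.
have -> : V *m adjoint V = Y - Z *m adjoint Z by rewrite -PZ addrK.
by rewrite mulmxBl top_proj_mul // -mulmxA ZX mulmx0 subr0.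
Qed.

Section LambdaAdm.
Context (B G : 'M[K]_n) (Bsa : selfadjoint B) (Gu : unitary G).
Hypotheses (BG : B *m G = G *m real_diag F n (fun i => eigval B i.+1))
  (gapj : eigengap B j) (gapk : eigengap B k).

Lemma lambda_adm_adm_proj (S : {vspace 'cV[K]_n}) : lambda_adm j h k B S ->
  adm_proj G (orthonormal_basis S *m adjoint (orthonormal_basis S)).
Proof.
case=> dS; have [V1 VS] := orthonormal_basisP S.
rewrite !(dominant_eigenspaceE Bsa Gu BG) // -[X in (_ <= X)%VS -> _]VS.
rewrite -[X in _ -> (X <= _)%VS -> _]VS.
rewrite /grassmannian /= in dS.
move: (orthonormal_basis S) V1 {VS}; rewrite dS => V V1.
move=> /(colspan_subvP _ V1) PX /(colspan_subvP _ (orthonormal_top_cols kn Gu)).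
rewrite top_colsK // => YV; exists V; split=> //; first by rewrite mulmxA YV.
by rewrite -(top_colsK G jn) mulmxA PX.
Qed.

Lemma adm_proj_lambda_adm (P : 'M[K]_n) : adm_proj G P ->
  exists2 S, lambda_adm j h k B S &
    P = orthonormal_basis S *m adjoint (orthonormal_basis S).
Proof.
case=> V [V1 PE YP PX]; have YV : top_proj k G *m V = V.
  by apply: orthonormal_proj_mul_id => //; rewrite -PE.
have T1 := orthonormal_top_cols jn Gu.
exists (colspan V).
  split; rewrite ?(dominant_eigenspaceE Bsa Gu BG) //.
  - by rewrite /grassmannian /= dim_colspan.
  - apply/colspan_subvP => //.
    by rewrite -PE; apply: orthonormal_proj_mul_id => //; rewrite top_colsK.
  - by apply/colspan_subvP; [exact: orthonormal_top_cols | rewrite top_colsK].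
have [U1 US] := orthonormal_basisP (colspan V).
rewrite PE; apply/esym/proj_unique => //; first by rewrite dim_colspan.
by apply/colspan_subvP => //; rewrite US.
Qed.

End LambdaAdm.
End AdmissibleProjections.

(** * Passage to the limit *)

Section ConditionNumber.
Context (R : realType) (F : scalar_kind).
Local Notation K := (scalar_field R F).
Local Notation real_diag := (@real_diag R F).
Context (n : nat) (N : 'M[K]_n -> R) (hN : unitarily_invariant_norm N).
Implicit Types A B : 'M[K]_n.

(** [x] is the part of the gap that Weyl's inequality may consume; the case [l = 0] encodes an
    infinite gap. *)
Definition gap_bound A l (x : R) : R :=
  if l == 0%N then 0 else (eigval A l - eigval A l.+1 - x)^-1.

Lemma gap_gt0 A l : (0 < l)%N -> eigengap A l -> 0 < eigval A l - eigval A l.+1.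
Proof. by case: l => // l _; rewrite /eigengap /lambda /= lte_fin subr_gt0. Qed.

Lemma gap_bound_cvg A l : eigengap A l ->
  gap_bound A l (eps / N (pid_mx 1)) @[eps --> 0^'+] --> gap_bound A l 0.
Proof.
rewrite /gap_bound; case: (posnP l) => [->|l0 gap]; first by move=> _; exact: cvg_cst.
apply: cvg_at_right_filter; apply: cvgV.
  by rewrite subr0 gt_eqF // gap_gt0.
apply: cvgB; first exact: cvg_cst.
rewrite -[X in _ --> X](mul0r (N (pid_mx 1))^-1).
by apply: cvgM; [exact: cvg_id | exact: cvg_cst].
Qed.

Lemma gap_near A l : eigengap A l -> \forall eps \near 0^'+,
  l = 0%N \/ eps / N (pid_mx 1) < eigval A l - eigval A l.+1.
Proof.
case: (posnP l) => [->|l0 gap]; first by move=> _; near=> eps; left.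
have c : (eps / N (pid_mx 1)) @[eps --> 0^'+] --> (0 : R).
  apply: cvg_at_right_filter; rewrite -[X in _ --> X](mul0r (N (pid_mx 1))^-1).
  by apply: cvgM; [exact: cvg_id | exact: cvg_cst].
near=> eps; right; near: eps; exact: (cvgr_lt _ c _ (gap_gt0 l0 gap)).
Unshelve. all: by end_near. Qed.

(** For [l = 0] both projections vanish. Otherwise [eigval B l] is at least
    [eigval A l - eps / N (pid_mx 1)] by Weyl, so the smallness of [eps] keeps the gap in
    Davis-Kahan positive and bounds its inverse. *)
Lemma top_proj_perturbation A B GA GB l eps :
  selfadjoint A -> selfadjoint B -> unitary GA -> unitary GB ->
  A *m GA = GA *m real_diag n (fun i => eigval A i.+1) ->
  B *m GB = GB *m real_diag n (fun i => eigval B i.+1) ->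
  (l < n)%N -> 0 < N (A - B) < eps ->
  l = 0%N \/ eps / N (pid_mx 1) < eigval A l - eigval A l.+1 ->
  N ((1%:M - top_proj l GA) *m top_proj l GB) <=
    N (A - B) * gap_bound A l (eps / N (pid_mx 1)).
Proof.
move=> Asa Bsa GAu GBu AG BG ln /andP[AB0 ABeps]; rewrite /gap_bound.
case: (posnP l) => [-> _|l0 [l00|small]].
- by rewrite /top_proj pid_mx_0 !(mulmx0, mul0mx) (uinorm0 hN) mulr0.
- by rewrite l00 in l0.
have n0 : (0 < n)%N := leq_ltn_trans (leq0n l) ln.
have pid0 : 0 < N (pid_mx 1).
  apply: (uinorm_gt0 hN); apply/matrix0Pn; exists (Ordinal n0), (Ordinal n0).
  by rewrite mxE eqxx oner_eq0.
have W : eigval A l - eigval B l <= eps / N (pid_mx 1).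
  apply: (le_trans (weyl hN Asa Bsa GAu AG GBu BG l0 (ltnW ln))).
  by rewrite ler_pM2r ?invr_gt0 // ltW.
have gap : eigval A l.+1 < eigval B l.
  by have := le_lt_trans W small; rewrite ltrD2l ltrN2.
apply: (le_trans (davis_kahan hN Asa Bsa GAu AG GBu BG l0 ln gap)).
rewrite (ler_pM2l AB0) lef_pV2 ?posrE ?subr_gt0; [|exact: gap|exact: small].
by rewrite addrAC lerD2r lerBlDl -lerBlDr.
Qed.

Lemma hausdorff_dist_le A B j d e eps : gapped j (j + d + e) A ->
  gapped j (j + d + e) B -> (j + d + e < n)%N -> 0 < N (A - B) < eps ->
  (forall l, (l == j) || (l == j + d + e)%N ->
    l = 0%N \/ eps / N (pid_mx 1) < eigval A l - eigval A l.+1) ->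
  (hausdorff_dist N (lambda_adm j (j + d) (j + d + e) A)
     (lambda_adm j (j + d) (j + d + e) B) <=
   (N (A - B) * (gap_bound A j (eps / N (pid_mx 1)) +
     gap_bound A (j + d + e) (eps / N (pid_mx 1))))%:E)%E.
Proof.
move=> [Asa Aj Ak] [Bsa Bj Bk] kn AB small.
have [GA [GAu AG]] := sorted_eigenbasis Asa.
have [GB [GBu BG]] := sorted_eigenbasis Bsa.
have jn : (j < n)%N by rewrite (leq_ltn_trans _ kn) // -addnA leq_addr.
have smallj : j = 0%N \/ eps / N (pid_mx 1) < eigval A j - eigval A j.+1.
  by apply: small; rewrite eqxx.
have smallk := small (j + d + e)%N; rewrite eqxx orbT in smallk.
have boundj := top_proj_perturbation Asa Bsa GAu GBu AG BG jn AB smallj.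
have boundk := top_proj_perturbation Asa Bsa GAu GBu AG BG kn AB (smallk isT).
rewrite mulrDr; rewrite /hausdorff_dist ge_max; apply/andP; split.
  apply: ge_ereal_sup => _ [S AS <-].
  have [P' /(adm_proj_lambda_adm (ltnW kn) Bsa GBu BG Bj Bk)[T BT TE] PP'] :=
    adm_proj_nearr (ltnW kn) hN GAu GBu (lambda_adm_adm_proj (ltnW kn) Asa GAu AG Aj Ak AS).
  apply: (@le_trans _ _ (N (sin_Theta S T))%:E).
    by apply: ereal_inf_lbound; exists T.
  rewrite lee_fin (uinorm_sin_Theta hN _ erefl erefl) -?TE; last first.
    by case: AS BT => + _ _ [+ _ _]; rewrite /grassmannian /= => -> ->.
  by rewrite (le_trans PP') // lerD.
apply: ge_ereal_sup => _ [T BT <-].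
have [P /(adm_proj_lambda_adm (ltnW kn) Asa GAu AG Aj Ak)[S AS SE] PP'] :=
  adm_proj_nearl (ltnW kn) hN GAu GBu (lambda_adm_adm_proj (ltnW kn) Bsa GBu BG Bj Bk BT).
apply: (@le_trans _ _ (N (sin_Theta S T))%:E).
  by apply: ereal_inf_lbound; exists S.
rewrite lee_fin (uinorm_sin_Theta hN _ erefl erefl) -?SE; last first.
  by case: AS BT => + _ _ [+ _ _]; rewrite /grassmannian /= => -> ->.
by rewrite (le_trans PP') // lerD.
Qed.

(** A larger [eps] admits more competitors [B], and monotone functions have one-sided limits in the
    extended reals. This makes the [lim] in [condition_number] a genuine limit. *)
Lemma sup_quotient_cvg (dom : set 'M[K]_n) f A :
  cvg (sup_quotient N dom f A eps @[eps --> 0^'+]).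
Proof.
apply: nondecreasing_at_right_is_cvge; near=> x => u v _ _ uv.
apply: ereal_sup_le => _ [B [domB /andP[AB0 ABu]] <-]; exists B => //.
by split=> //; rewrite AB0 (lt_le_trans ABu).
Unshelve. all: by end_near. Qed.

Lemma condition_number_le A j d e : (j + d + e < n)%N ->
  gapped j (j + d + e) A ->
  (condition_number N (gapped j (j + d + e)) (lambda_adm j (j + d) (j + d + e)) A <=
    (gap_bound A j 0 + gap_bound A (j + d + e) 0)%:E)%E.
Proof.
move=> kn Agap; have [Asa Aj Ak] := Agap.
(* For fixed [eps] the available bound uses the reduced gaps; the slack [eta] absorbs the excess
   once [eps] is small. *)
apply/lee_addgt0Pr => eta eta0; rewrite -EFinD.
apply: lime_le; first exact: sup_quotient_cvg.
have c : gap_bound A j (eps / N (pid_mx 1)) +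
    gap_bound A (j + d + e) (eps / N (pid_mx 1)) @[eps --> 0^'+] -->
    gap_bound A j 0 + gap_bound A (j + d + e) 0.
  by apply: cvgD; apply: gap_bound_cvg.
near=> eps.
apply: ge_ereal_sup => _ [B [Bgap AB] <-]; have [AB0 ABeps] := andP AB.
rewrite lee_pdivrMr // -EFinM.
apply: (le_trans (hausdorff_dist_le Agap Bgap kn AB _)).
  by move=> l /orP[] /eqP ->; near: eps; apply: gap_near.
rewrite lee_fin mulrC ler_pM2r //.
near: eps; apply: (cvgr_le _ c); by rewrite ltrDl.
Unshelve. all: by end_near. Qed.

End ConditionNumber.

Theorem theorem4p12 (R : realType) (F : scalar_kind) (n j h k : nat)
    (N : 'M[scalar_field R F]_n -> R) (A : 'M[scalar_field R F]_n)
    (hN : unitarily_invariant_norm N)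
    (hA : selfadjoint A)
    (hjh : (j < h)%N) (hhk : (h < k)%N)
    (hkrank : (k <= \rank A)%N) (hkn : (k < n)%N)
    (hgapj : (lambda A j.+1 < lambda A j)%E)
    (hgapk : (lambda A k.+1 < lambda A k)%E) :
  cvg (sup_quotient N (@gapped R F n j k) (@lambda_adm R F n j h k) A eps
         @[eps --> 0^'+]) /\
  (condition_number N (@gapped R F n j k) (@lambda_adm R F n j h k) A <=
    ((if j == 0%N then 0 else (eigval A j - eigval A j.+1)^-1) +
     (eigval A k - eigval A k.+1)^-1)%:E)%E.
Proof.
split; first exact: sup_quotient_cvg.
have k0 : k != 0%N by rewrite -lt0n (leq_ltn_trans (leq0n h) hhk).
have hE : h = (j + (h - j))%N by rewrite subnKC // ltnW.
have kE : k = (j + (h - j) + (k - h))%N by rewrite -hE subnKC // ltnW.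
have -> : (if j == 0%N then 0 else (eigval A j - eigval A j.+1)^-1) +
    (eigval A k - eigval A k.+1)^-1 = gap_bound A j 0 + gap_bound A k 0.
  by rewrite /gap_bound (negPf k0) !subr0.
move: (h - j)%N (k - h)%N hE kE => d e hE kE; subst h k.
by apply: condition_number_le.
Qed.
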